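(* For Lebesgue-almost every $(l_1,l_2,l_3,L)\in\mathbb{R}_{>0}^4$ satisfying $$\max\{0,\;l_1-l_2-l_3,\;-l_1+l_2-l_3,\;-l_1-l_2+l_3\}<L<l_1+l_2+l_3,$$ $$T_1:=-l_1+l_2-l_3+L>0,\qquad T_2:=-l_1-l_2+l_3+L>0,\qquad T_3:=-l_1+l_2+l_3-L<0,$$ and $$l_2\le\min\{l_1,l_3\}\quad\text{or}\quad l_2\ge\max\{l_1,l_3\},$$ the following holds for the four-bar linkage with lengths $(l_1,l_2,l_3,L)$: for every configuration $\mathcal{C}$, every configuration $\mathcal{C}'$ that can be reached from $\mathcal{C}$ by smooth motion, and every $\varepsilon>0$, there is a finite sequence of pops, alternating between the pop of bars $1$-$2$ and the pop of bars $2$-$3$, which transforms $\mathcal{C}$ into a configuration in which every vertex is at distance at most $\varepsilon$ from its position in $\mathcal{C}'$.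
   Context: A four-bar linkage with lengths $(l_1,l_2,l_3,L)$ (all positive) lies in the Euclidean plane $\mathbb{R}^2$. It consists of a fixed (ground) bar of length $L$ with endpoints $A=(0,0)$ and $D=(L,0)$, together with bars 1, 2, 3 of lengths $l_1,l_2,l_3$ joined consecutively from $A$ to $D$. A configuration is a pair of points $(B,C)\in\mathbb{R}^2\times\mathbb{R}^2$ with $|AB|=l_1$, $|BC|=l_2$, $|CD|=l_3$; bars are allowed to intersect. The vertices are $A,B,C,D$, and $A,D$ never move. A configuration $\mathcal{C}'$ can be reached from $\mathcal{C}$ by smooth motion if the two are joined by a continuous path in the set of configurations. The pop of bars $1$-$2$ replaces $B$ by its reflection across the line through $A$ and $C$, leaving $C$ fixed. The pop of bars $2$-$3$ replaces $C$ by its reflection across the line through $B$ and $D$, leaving $B$ fixed. *)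

(* Defs.v *)
From HB Require Import structures.
From mathcomp Require Import all_boot all_order all_algebra.
From mathcomp Require Import all_classical all_reals all_analysis.

Set Implicit Arguments.
Unset Strict Implicit.
Unset Printing Implicit Defensive.
Import Order.TTheory GRing.Theory Num.Theory.
Import numFieldNormedType.Exports.
Local Open Scope classical_set_scope.
Local Open Scope ring_scope.

Section FourBar.
Variable R : realType.
Implicit Types P Q X : (R * R)%type.

(* The library norm on R * R is the max norm, hence an explicit Euclidean
   distance.  Both induce the product topology, which is the one used for
   continuity below. *)
Definition dist P Q : R :=
  Num.sqrt ((P.1 - Q.1) ^+ 2 + (P.2 - Q.2) ^+ 2).

(* P + 2 proj_(Q-P)(X-P) - (X-P): only meaningful when P <> Q. *)
Definition reflection P Q X : R * R :=
  let t := ((X.1 - P.1) * (Q.1 - P.1) + (X.2 - P.2) * (Q.2 - P.2))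
           / ((Q.1 - P.1) ^+ 2 + (Q.2 - P.2) ^+ 2) in
  (P.1 + 2 * t * (Q.1 - P.1) - (X.1 - P.1),
   P.2 + 2 * t * (Q.2 - P.2) - (X.2 - P.2)).

(* A pair of points (B, C). *)
Definition config : Type := ((R * R) * (R * R))%type.

Definition groundA : R * R := (0, 0).
Definition groundD (L : R) : R * R := (L, 0).

Definition configurations (l1 l2 l3 L : R) : set config :=
  [set c | dist groundA c.1 = l1 /\ dist c.1 c.2 = l2 /\
           dist c.2 (groundD L) = l3].

Definition vertices (L : R) (c : config) : seq (R * R) :=
  [:: groundA; c.1; c.2; groundD L].

Definition reachable (l1 l2 l3 L : R) (c c' : config) : Prop :=
  exists gamma : R -> config,
    [/\ {within `[0, 1], continuous gamma}, gamma 0 = c, gamma 1 = c' &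
        forall t, t \in `[0, 1] -> configurations l1 l2 l3 L (gamma t)].

Inductive pop_kind := Pop12 | Pop23.

Definition other_pop (k : pop_kind) : pop_kind :=
  match k with Pop12 => Pop23 | Pop23 => Pop12 end.

(* A pop is a relation because it is undefined when the two points that should
   span the mirror line coincide. *)
Definition pop (L : R) (k : pop_kind) (c c' : config) : Prop :=
  match k with
  | Pop12 => groundA <> c.2 /\ c' = (reflection groundA c.2 c.1, c.2)
  | Pop23 => c.1 <> groundD L /\ c' = (c.1, reflection c.1 (groundD L) c.2)
  end.

(* n alternating pops, the first one (if any) being of kind k. *)
Fixpoint alternating_pops (L : R) (k : pop_kind) (n : nat)
    (c c' : config) : Prop :=
  if n is m.+1 then
    exists2 c1, pop L k c c1 & alternating_pops L (other_pop k) m c1 c'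
  else c = c'.

(* Lebesgue measure on R^4, as a measure on the Borel sets. Its negligible
   sets are the subsets of Borel null sets, i.e. the Lebesgue null sets. *)
Definition lebesgue4 : set (R * R * R * R) -> \bar R :=
  (lebesgue_measure \x lebesgue_measure \x lebesgue_measure
     \x lebesgue_measure)%E.

End FourBar.

(* Main.v *)
(* Fix L, l1, l3 and let F be the composition of the pop of bars 1-2 with the pop
   of bars 2-3. In the angles alpha of AB and gamma of DC, each pop preserves
   |BC|^2 and reverses the area form, hence it reverses the Hamiltonian flow of
   |BC|^2. The hypotheses make L the longest bar of a non-Grashof linkage, whose
   configurations form a single periodic orbit of this flow, with an explicit
   parametrization. So the pops act on the time t of that orbit as
   t |-> a - t and t |-> b - t, F is a rotation, and its orbits are dense unless
   some iterate of F has a fixed point.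
   For a fixed n >= 1, the iterate F^n has a fixed point on the orbit for only
   finitely many l2. Indeed F^n would then fix the configuration with
   B = (l1, 0), and along all configurations with this B the map F^n is rational
   in tan (gamma / 2); it is not the identity there because gamma = 0 is a
   hyperbolic fixed point of F. By Fubini the exceptional lengths form a null
   set. *)
Require Import Defs.
From HB Require Import structures.
From mathcomp Require Import all_boot all_order all_algebra.
From mathcomp Require Import all_classical all_reals all_analysis.
From mathcomp Require Import measurable_realfun ring lra.
Import Order.TTheory GRing.Theory Num.Theory.
Import numFieldNormedType.Exports.
Local Open Scope classical_set_scope.
Local Open Scope ring_scope.

Set Implicit Arguments.
Unset Strict Implicit.
Unset Printing Implicit Defensive.

(** * Real rational functions without poles *)

Section Rational.
Context {R : realType}.
Implicit Types f g : R -> R.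

(** Denominators without real zeros make the class closed under pointwise sums and products, with no
    exceptional points. *)
Definition rational f := exists p q : {poly R},
  (forall x, q.[x] != 0) /\ (forall x, f x = p.[x] / q.[x]).

Lemma rational_poly (p : {poly R}) : rational (horner p).
Proof. by exists p, 1; split=> x; rewrite hornerC ?oner_eq0 ?divr1. Qed.

Lemma rational_cst (a : R) : rational (fun=> a).
Proof. by have := rational_poly a%:P; congr rational; apply/funext => x; rewrite hornerC. Qed.

Lemma rationalD f g : rational f -> rational g -> rational (fun x => f x + g x).
Proof.
move=> [p [q [q0 fE]]] [r [s [s0 gE]]]; exists (p * s + r * q), (q * s).
split=> x; rewrite ?hornerD !hornerM ?mulf_neq0// fE gE.
by rewrite addf_div.
Qed.

Lemma rationalM f g : rational f -> rational g -> rational (fun x => f x * g x).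
Proof.
move=> [p [q [q0 fE]]] [r [s [s0 gE]]]; exists (p * r), (q * s).
by split=> x; rewrite !hornerM ?mulf_neq0// fE gE mulf_div.
Qed.

Lemma rationalV f : rational f -> (forall x, f x != 0) -> rational (fun x => (f x)^-1).
Proof.
move=> [p [q [q0 fE]]] f0; exists q, p; split=> x; last by rewrite fE invf_div.
by apply: contra_neq (f0 x) => p0; rewrite fE p0 mul0r.
Qed.

Lemma rationalN f : rational f -> rational (fun x => - f x).
Proof.
move=> /(rationalM (rational_cst (-1))).
by congr rational; apply/funext => x; rewrite mulN1r.
Qed.

Lemma rationalB f g : rational f -> rational g -> rational (fun x => f x - g x).
Proof. by move=> rf /rationalN; exact: rationalD. Qed.

Lemma rationalX f n : rational f -> rational (fun x => f x ^+ n).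
Proof.
move=> rf; elim: n => [|n ih]; first exact: rational_cst.
by have := rationalM rf ih; congr rational; apply/funext => x; rewrite exprS.
Qed.

(** The value at [x0] makes the numerator [p] a nonzero polynomial; an infinite zero set would
    contain [size p] distinct roots of it, one too many. *)
Lemma rational_zeros f x0 : rational f -> f x0 != 0 -> finite_set [set x | f x = 0].
Proof.
move=> [p [q [q0 fE]]] fx0.
have p_neq0 : p != 0 by apply: contra_neq fx0 => p0; rewrite fE p0 horner0 mul0r.
apply: contrapT => /infinite_set_fset-/(_ (size p))[B Bf sB].
have /(max_poly_roots p_neq0)/(_ (finmap.fset_uniq B)) : all (root p) (finmap.enum_fset B).
  apply/allP => x xB; have /= := Bf _ xB; rewrite fE => /eqP.
  by rewrite mulf_eq0 invr_eq0 (negbTE (q0 x)) orbF.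
by rewrite ltnNge sB.
Qed.

End Rational.

(** * Fixed points of the iterates of F among the configurations with B = (l1, 0) *)

Section Torsion.
Context {R : realType}.

(** The map F. It is total, since division by 0 gives 0 when a mirror degenerates, so it can be
    iterated and measured without side conditions. *)
Definition fold (L : R) (c : config R) : config R :=
  let B := reflection (groundA R) c.2 c.1 in (B, reflection B (groundD L) c.2).

(** The point C at angle gamma on the circle about D, with u = tan (gamma / 2). *)
Definition half_angle (l3 L u : R) : R * R :=
  (L + l3 * (1 - u ^+ 2) / (1 + u ^+ 2), l3 * (2 * u) / (1 + u ^+ 2)).

(* At u = 0 the configuration is the saddle point B = (l1, 0), C = (L + l3, 0),
   and (x, y) are the derivatives of the second coordinates of B and C there. *)
Definition saddle_jet (l1 l3 L : R) (z : R -> config R) (x y : R) :=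
  exists b be c ga : R -> R,
    [/\ [/\ rational b, rational be, rational c & rational ga],
        forall u, z u = ((b u, u * be u), (c u, u * ga u)),
        [/\ b 0 = l1, be 0 = x, c 0 = L + l3 & ga 0 = y] &
        forall u, b u ^+ 2 + (u * be u) ^+ 2 = l1 ^+ 2 /\
                  (c u - L) ^+ 2 + (u * ga u) ^+ 2 = l3 ^+ 2].

Lemma rational_id : rational (@id R).
Proof.
have -> : @id R = horner 'X by apply/funext => x; rewrite hornerX.
exact: rational_poly.
Qed.

(** Both reflections preserve the factor u of the second coordinates and act linearly on the
    cofactors at u = 0. The mirrors never degenerate, because C has abscissa at least L - l3 > 0 and
    B at most l1 < L. *)
Lemma saddle_jet_fold (l1 l3 L : R) z x y : 0 < l1 -> 0 < l3 -> l1 < L -> l3 < L ->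
  saddle_jet l1 l3 L z x y ->
  let x' := 2 * l1 / (L + l3) * y - x in
  saddle_jet l1 l3 L (fold L \o z) x' (- (2 * l3 / (L - l1)) * x' - y).
Proof.
move=> l1_gt0 l3_gt0 l1L l3L [b [be [c [ga [[rb rbe rc rga] zE [b0 be0 c0 ga0] bc]]]]] x'.
have ngt0 u : 0 < c u ^+ 2 + (u * ga u) ^+ 2.
  have [_ cu] := bc u; move: cu; set d := u * _ => cu.
  have ? : L - c u <= l3 by nra.
  have ? : 0 < c u by lra.
  nra.
have n0 u : c u ^+ 2 + (u * ga u) ^+ 2 != 0 by rewrite gt_eqF.
(* [t] here and [s] below are the projection coefficients inside the two reflections. *)
pose t u := (b u * c u + u * u * (be u * ga u)) / (c u ^+ 2 + (u * ga u) ^+ 2).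
pose b' u := 2 * t u * c u - b u.
pose be' u := 2 * t u * ga u - be u.
have bE u : b' u ^+ 2 + (u * be' u) ^+ 2 = l1 ^+ 2.
  by rewrite -(bc u).1 /b' /be' /t; field.
have mgt0 u : 0 < (L - b' u) ^+ 2 + (u * be' u) ^+ 2.
  move: (bE u); set d := u * _ => bu.
  have ? : b' u <= l1 by nra.
  nra.
have m0 u : (L - b' u) ^+ 2 + (u * be' u) ^+ 2 != 0 by rewrite gt_eqF.
pose s u := ((c u - b' u) * (L - b' u) - u * u * ((ga u - be' u) * be' u)) /
  ((L - b' u) ^+ 2 + (u * be' u) ^+ 2).
pose c' u := b' u + 2 * s u * (L - b' u) - (c u - b' u).
pose ga' u := be' u - 2 * s u * be' u - (ga u - be' u).
have rt : rational t.
  apply: rationalM; last apply: rationalV => //.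
    apply: rationalD; first exact: rationalM.
    by do 2!apply: rationalM => //; exact: rational_id.
  by apply: rationalD; apply: rationalX => //; apply: rationalM => //; exact: rational_id.
have r2t : rational (fun u => 2 * t u) by apply: rationalM => //; exact: rational_cst.
have rb' : rational b' by apply: rationalB => //; exact: rationalM.
have rbe' : rational be' by apply: rationalB => //; exact: rationalM.
have rL : rational (fun u => L - b' u) by apply: rationalB => //; exact: rational_cst.
have rs : rational s.
  apply: rationalM; last apply: rationalV => //.
    apply: rationalB; first by apply: rationalM => //; exact: rationalB.
    apply: rationalM; first by apply: rationalM => //; exact: rational_id.
    by apply: rationalM => //; exact: rationalB.
  by apply: rationalD; apply: rationalX => //; apply: rationalM => //; exact: rational_id.
have r2s : rational (fun u => 2 * s u) by apply: rationalM => //; exact: rational_cst.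
exists b', be', c', ga'; split.
- split=> //.
    by apply: rationalB; [apply: rationalD => //; exact: rationalM|exact: rationalB].
  by apply: rationalB; [apply: rationalB => //; exact: rationalM|exact: rationalB].
- move=> u; rewrite /= zE /fold /=.
  have -> : reflection (groundA R) (c u, u * ga u) (b u, u * be u) = (b' u, u * be' u).
    by rewrite /reflection /= !subr0 !add0r /b' /be' /t; congr pair; field.
  congr pair; rewrite /reflection /c' /ga' /s /groundD /=.
  by congr pair; field; exact: m0.
- have Ll : L - l1 != 0 by rewrite subr_eq0 gt_eqF.
  have Ll3 : L + l3 != 0 by rewrite gt_eqF//; lra.
  have t0 : t 0 = l1 / (L + l3).
    by rewrite /t b0 c0; field.
  have b'0 : b' 0 = l1 by rewrite /b' t0 c0 b0; field.
  have be'0 : be' 0 = x' by rewrite /be' t0 ga0 be0 /x'; field.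
  have s0 : s 0 = (L + l3 - l1) / (L - l1) by rewrite /s b'0 c0; field.
  split=> //; rewrite /c' /ga' s0 ?b'0 ?c0 ?be'0 ?ga0; field => //.
- move=> u; split=> //; rewrite -(bc u).2 /c' /ga' /s.
  by move: (m0 u); generalize (b' u) (be' u) => p q pq0; field.
Qed.

(** Hyperbolicity of the saddle: the cone of jets whose x and y have opposite signs is invariant,
    and there each application of F strictly increases |y|. *)
Lemma saddle_jet_iter (l1 l3 L : R) z g n : 0 < l1 -> 0 < l3 -> l1 < L -> l3 < L ->
  0 < g -> saddle_jet l1 l3 L z 0 g ->
  exists x y, [/\ saddle_jet l1 l3 L (fun u => iter n.+1 (fold L) (z u)) x y,
    g < `|y| & (x <= 0 /\ 0 <= y) \/ (0 <= x /\ y <= 0)].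
Proof.
move=> l1_gt0 l3_gt0 l1L l3L g_gt0 jz.
(* The weak bound holds already for no iteration; one further step makes it strict. *)
pose P m := exists x y, [/\ saddle_jet l1 l3 L (fun u => iter m (fold L) (z u)) x y,
  g <= `|y| & (x <= 0 /\ 0 <= y) \/ (0 <= x /\ y <= 0)].
have a_gt0 : 0 < 2 * l1 / (L + l3) by rewrite divr_gt0//; lra.
have c_gt0 : 0 < 2 * l3 / (L - l1) by rewrite divr_gt0//; lra.
have step m : P m -> exists x y,
    [/\ saddle_jet l1 l3 L (fun u => iter m.+1 (fold L) (z u)) x y,
    g < `|y| & (x <= 0 /\ 0 <= y) \/ (0 <= x /\ y <= 0)].
  move=> [x [y [jm gy xy]]].
  have := saddle_jet_fold l1_gt0 l3_gt0 l1L l3L jm => /=.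
  move: a_gt0 c_gt0; set a := 2 * l1 / _; set d := 2 * l3 / _ => a_gt0 c_gt0 jm'.
  exists (a * y - x), (- d * (a * y - x) - y); split => //.
    case: xy => -[x0 y0]; move: gy.
      rewrite ger0_norm// => gy; have w0 : 0 < a * y - x by nra.
      by rewrite ltr0_norm; nra.
    rewrite ler0_norm// => gy; have w0 : a * y - x < 0 by nra.
    by rewrite gtr0_norm; nra.
  case: xy => -[x0 y0]; [right|left].
    have w0 : 0 <= a * y - x by nra.
    by split=> //; nra.
  have w0 : a * y - x <= 0 by nra.
  by split=> //; nra.
apply: (step); elim: n => [|n /step [x [y [j /ltW gy xy]]]]; last by exists x, y.
by exists 0, g; split; [|rewrite gtr0_norm|left; split; lra].
Qed.

(** For u != 0 a factor u cancels from the equation. What remains compares two rational functions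
    that differ at u = 0, where one is 2 * l3 and the other is larger in absolute value. *)
Lemma fold_torsion_finite (l1 l3 L : R) n : 0 < l1 -> 0 < l3 -> l1 < L -> l3 < L ->
  finite_set [set u | u != 0 /\
    (iter n.+1 (fold L) ((l1, 0), half_angle l3 L u)).2.2 = (half_angle l3 L u).2].
Proof.
move=> l1_gt0 l3_gt0 l1L l3L.
have d0 (u : R) : 1 + u ^+ 2 != 0 by rewrite gt_eqF//; nra.
have rid := rational_id.
have rd : rational (fun u : R => (1 + u ^+ 2)^-1).
  apply: rationalV => //; apply: rationalD; [exact: rational_cst|exact: rationalX].
pose g0 (u : R) := 2 * l3 / (1 + u ^+ 2).
have rg0 : rational g0 by apply: rationalM => //; exact: rational_cst.
pose z u : config R := ((l1, 0), half_angle l3 L u).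
have j0 : saddle_jet l1 l3 L z 0 (2 * l3).
  exists (fun=> l1), (fun=> 0), (fun u => L + l3 * (1 - u ^+ 2) / (1 + u ^+ 2)), g0.
  split.
  - split=> //; do ?exact: rational_cst.
    apply: rationalD; first exact: rational_cst.
    apply: rationalM => //; apply: rationalM; first exact: rational_cst.
    apply: rationalB; [exact: rational_cst|exact: rationalX].
  - by move=> u; rewrite /z /half_angle /g0 mulr0; congr (_, (_, _)); field.
  - by rewrite /g0; split=> //; field.
  - by move=> u; split; [ring|rewrite /g0; field].
have g_gt0 : 0 < 2 * l3 by lra.
have [x [y [[b [be [c [ga [[_ _ _ rga] zE [_ _ _ ga0] _]]]]] gy _]]] :=
  saddle_jet_iter n l1_gt0 l3_gt0 l1L l3L g_gt0 j0.
have : finite_set [set u | ga u - g0 u = 0].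
  apply: (@rational_zeros _ _ 0); first exact: rationalB.
  rewrite ga0 /g0 expr0n addr0 divr1 subr_eq0.
  by apply: contraTneq gy => ->; rewrite gtr0_norm// ltxx.
apply: sub_finite_set => u [u0]; rewrite -/(z u) zE /= /half_angle /= => e.
apply: (mulfI u0); rewrite mulrBr e /g0; field; exact: d0.
Qed.

End Torsion.

(** * Sigma-finiteness of product measures *)

Section SigmaFiniteProduct.
Context d1 d2 (T1 : measurableType d1) (T2 : measurableType d2) (R : realType).
Context (m1 : {sigma_finite_measure set T1 -> \bar R}).
Context (m2 : {sigma_finite_measure set T2 -> \bar R}).

(* The library only infers sigma-finiteness of [m1 \x m2] for subprobabilities. *)
Definition sigma_finite_product : set (T1 * T2) -> \bar R := (m1 \x m2)%E.

HB.instance Definition _ := Measure.on sigma_finite_product.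

Lemma sigma_finite_productT : sigma_finite setT sigma_finite_product.
Proof.
have /sigma_finiteP[F [FT F_incr F_fin]] := sigma_finiteT m1.
have /sigma_finiteP[G [GT G_incr G_fin]] := sigma_finiteT m2.
exists (fun n => F n `*` G n) => [|n].
  apply/esym/seteqP; split=> // -[x y] _.
  have [i _ Fix] : (\bigcup_n F n) x by rewrite -FT.
  have [j _ Gjy] : (\bigcup_n G n) y by rewrite -GT.
  exists (maxn i j) => //; split=> /=.
    by have /subsetPset := F_incr _ _ (leq_maxl i j); exact.
  by have /subsetPset := G_incr _ _ (leq_maxr i j); exact.
have [mF Ffin] := F_fin n; have [mG Gfin] := G_fin n.
split; first exact: measurableX.
by rewrite /sigma_finite_product product_measure1E// lte_mul_pinfty// ge0_fin_numE.
Qed.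

HB.instance Definition _ := Measure_isSigmaFinite.Build _ _ _
  sigma_finite_product sigma_finite_productT.

End SigmaFiniteProduct.

(** * The exceptional lengths form a Lebesgue null set *)

Section NullSets.
Context {R : realType}.

(** The product measure integrates x-sections; by uniqueness it equals the one that integrates
    y-sections. *)
Lemma product_measure_null_ysection d1 d2 (T1 : measurableType d1)
    (T2 : measurableType d2) (m1 : {sigma_finite_measure set T1 -> \bar R})
    (m2 : {sigma_finite_measure set T2 -> \bar R}) (A : set (T1 * T2)) :
  measurable A -> (forall y, m1 (ysection A y) = 0%E) ->
  sigma_finite_product m1 m2 A = 0%E.
Proof.
move=> mA A0; rewrite /sigma_finite_product.
rewrite (product_measure_unique (m' := (m1 \x^ m2)%E))//=; last first.
  by move=> B C mB mC; rewrite product_measure2E.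
by apply: integral0_eq => y _; exact: A0.
Qed.

(** The second coordinate is singled out because it will be l2. The last two are removed by
    y-sections, the first by x-sections. *)
Lemma product_measure4_null d (T : measurableType d)
    (m : {sigma_finite_measure set T -> \bar R}) (A : set (T * T * T * T)) :
  measurable A -> (forall x y z, m [set w | A (x, w, y, z)] = 0%E) ->
  (m \x m \x m \x m)%E A = 0%E.
Proof.
move=> mA A0.
pose m2 := sigma_finite_product m m; pose m3 := sigma_finite_product m2 m.
apply: (@product_measure_null_ysection _ _ _ _ m3 m) => // z.
apply: (@product_measure_null_ysection _ _ _ _ m2 m) => [|y].
  exact: measurable_ysection.
apply: integral0_eq => x _; rewrite -[RHS](A0 x y z) /=.
by rewrite xsectionE/= ysectionE/= ysectionE.
Qed.

Lemma lebesgue4_null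
    (A : set (measurableTypeR R * measurableTypeR R * measurableTypeR R * measurableTypeR R)) :
  measurable A -> (forall l1 l3 L, countable [set l2 | A (l1, l2, l3, L)]) ->
  lebesgue4 A = 0%E.
Proof.
move=> mA cA; apply: product_measure4_null => // l1 l3 L.
exact: countable_lebesgue_measure0.
Qed.

Lemma measurable_fun_div_ge0 d (T : measurableType d) (f g : T -> R) :
  measurable_fun setT f -> measurable_fun setT g -> (forall x, 0 <= g x) ->
  measurable_fun setT (fun x => f x / g x).
Proof.
move=> mf mg g0; apply: measurable_funM => //.
rewrite (_ : (fun x => _) = (@powR R ^~ (-1)) \o g); last first.
  by apply/funext => x /=; rewrite powR_inv1.
exact: measurableT_comp.
Qed.

(** Writing 1 / f as f / f^2 reduces to a nonnegative denominator; at a zero of f both sides are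
    0. *)
Lemma measurable_fun_inv d (T : measurableType d) (f : T -> R) :
  measurable_fun setT f -> measurable_fun setT (fun x => (f x)^-1).
Proof.
move=> mf; rewrite (_ : (fun x => _) = (fun x => f x / f x ^+ 2)); last first.
  apply/funext => x; have [->|fx0] := eqVneq (f x) 0; first by rewrite invr0 mul0r.
  by field.
by apply: measurable_fun_div_ge0 => //; [exact: measurable_funX|move=> x; exact: sqr_ge0].
Qed.

Lemma measurable_fun_sqrt d (T : measurableType d) (f : T -> R) :
  measurable_fun setT f -> measurable_fun setT (fun x => Num.sqrt (f x)).
Proof.
by apply: measurableT_comp; apply: continuous_measurable_fun; exact: sqrt_continuous.
Qed.

Lemma measurable_reflection d (T : measurableType d) (P Q X : T -> R * R) :
  measurable_fun setT P -> measurable_fun setT Q -> measurable_fun setT X ->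
  measurable_fun setT (fun t => reflection (P t) (Q t) (X t)).
Proof.
move=> /measurable_fun_pairP[P1 P2] /measurable_fun_pairP[Q1 Q2].
move=> /measurable_fun_pairP[X1 X2].
have mt : measurable_fun setT (fun t =>
   (((X t).1 - (P t).1) * ((Q t).1 - (P t).1) + ((X t).2 - (P t).2) * ((Q t).2 - (P t).2))
   / (((Q t).1 - (P t).1) ^+ 2 + ((Q t).2 - (P t).2) ^+ 2)).
  apply: measurable_funM.
    by apply: measurable_funD; apply: measurable_funM; apply: measurable_funB.
  by apply: measurable_fun_inv; apply: measurable_funD; apply: measurable_funX;
    apply: measurable_funB.
apply: measurable_fun_pair; apply: measurable_funB; try exact: measurable_funB.
  apply: measurable_funD => //; apply: measurable_funM; last exact: measurable_funB.
  exact: measurable_funM.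
apply: measurable_funD => //; apply: measurable_funM; last exact: measurable_funB.
exact: measurable_funM.
Qed.

Lemma measurable_fold d (T : measurableType d) (L : T -> R) (c : T -> config R) :
  measurable_fun setT L -> measurable_fun setT c ->
  measurable_fun setT (fun t => fold (L t) (c t)).
Proof.
move=> mL /measurable_fun_pairP[c1 c2].
have mB : measurable_fun setT (fun t => reflection (groundA R) (c t).2 (c t).1).
  exact: measurable_reflection.
apply: measurable_fun_pair => //; apply: measurable_reflection => //.
exact: measurable_fun_pair.
Qed.

(* The configuration of the linkage with B on the ground line and C above it. *)
Definition aligned_config (p : R * R * R * R) : config R :=
  let: (l1, l2, l3, L) := p in
  let x := (l2 ^+ 2 - (L - l1) ^+ 2 - l3 ^+ 2) / (2 * (L - l1)) in
  ((l1, 0), (L + x, Num.sqrt (l3 ^+ 2 - x ^+ 2))).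

(** Adding the last three inequalities in pairs shows that L is the longest bar; then they say that
    L plus the shortest bar exceeds the sum of the other two, so Grashof's condition fails. *)
Definition non_grashof (p : R * R * R * R) : bool :=
  let: (l1, l2, l3, L) := p in
  [&& 0 < l1, 0 < l2, 0 < l3, 0 < L, L < l1 + l2 + l3, l1 + l3 < l2 + L,
      l1 + l2 < l3 + L & l2 + l3 < l1 + L].

(** Comparing only the height of C gives a set containing every case where an iterate of F fixes the
    aligned configuration, and this set is still null. *)
Definition torsion : set (R * R * R * R) :=
  \bigcup_n [set p | non_grashof p &&
    ((iter n.+1 (fold p.2) (aligned_config p)).2.2 == (aligned_config p).2.2)].

Lemma measurable_torsion d (T : measurableType d) (l1 l2 l3 L : T -> R) :
  measurable_fun setT l1 -> measurable_fun setT l2 -> measurable_fun setT l3 ->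
  measurable_fun setT L -> measurable [set t | torsion (l1 t, l2 t, l3 t, L t)].
Proof.
move=> m1 m2 m3 mL.
have mx : measurable_fun setT (fun t =>
   (l2 t ^+ 2 - (L t - l1 t) ^+ 2 - l3 t ^+ 2) / (2 * (L t - l1 t))).
  apply: measurable_funM.
    by do 2?[apply: measurable_funB]; apply: measurable_funX => //; exact: measurable_funB.
  by apply: measurable_fun_inv; apply: measurable_funM => //; exact: measurable_funB.
have mc : measurable_fun setT (fun t => aligned_config (l1 t, l2 t, l3 t, L t)).
  apply: measurable_fun_pair; first exact: measurable_fun_pair.
  apply: measurable_fun_pair; first exact: measurable_funD.
  by apply: measurable_fun_sqrt; apply: measurable_funB; exact: measurable_funX.
have mi n : measurable_fun setT (fun t =>
    iter n (fold (L t)) (aligned_config (l1 t, l2 t, l3 t, L t))).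
  by elim: n => // n ih; exact: measurable_fold.
have m22 (f : T -> config R) :
    measurable_fun setT f -> measurable_fun setT (fun p => (f p).2.2).
  by move=> /measurable_fun_pairP[_ /measurable_fun_pairP[]].
rewrite (_ : [set t | _] = \bigcup_n [set t | non_grashof (l1 t, l2 t, l3 t, L t) &&
  ((iter n.+1 (fold (L t)) (aligned_config (l1 t, l2 t, l3 t, L t))).2.2 ==
    (aligned_config (l1 t, l2 t, l3 t, L t)).2.2)]) //.
apply: bigcupT_measurable => n.
rewrite -[X in measurable X]setTI; apply: (_ : measurable_fun setT _) => //.
apply: measurable_and; last first.
  by apply: measurable_fun_eqr; apply: m22 => //; exact: mi.
do 7?[apply: measurable_and]; apply: measurable_fun_ltr => //;
  by do 2?[apply: measurable_funD => //].
Qed.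

(** With C - D = (x, y), the law of cosines gives x, and u = y / (l3 + x) is tan (gamma / 2). The
    last equation recovers l2 from u, so finitely many u leave finitely many l2. *)
Lemma aligned_config_half_angle (l1 l2 l3 L : R) : non_grashof (l1, l2, l3, L) ->
  exists u, [/\ u != 0, aligned_config (l1, l2, l3, L) = ((l1, 0), half_angle l3 L u) &
    l2 = dist (l1, 0) (half_angle l3 L u)].
Proof.
rewrite /aligned_config; set x := (_ / _).
move=> /and5P[l1_gt0 l2_gt0 l3_gt0 L_gt0 /and4P[L123 h13 h12 h23]].
have Ll : 0 < L - l1 by lra.
have Ll0 : L - l1 != 0 by rewrite gt_eqF.
have xE : 2 * (L - l1) * x = l2 ^+ 2 - (L - l1) ^+ 2 - l3 ^+ 2.
  by rewrite /x; field.
(* [x1] and [x2] hold because the triangle with sides L - l1, l2, l3 is nondegenerate. *)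
have x1 : - l3 < x.
  rewrite -(ltr_pM2l (_ : 0 < 2 * (L - l1))) ?xE; last by lra.
  have : (L - l1 - l3) ^+ 2 < l2 ^+ 2 by nra.
  by nra.
have x2 : x < l3.
  rewrite -(ltr_pM2l (_ : 0 < 2 * (L - l1))) ?xE; last by lra.
  have : l2 ^+ 2 < (L - l1 + l3) ^+ 2 by nra.
  by nra.
have y_gt0 : 0 < l3 ^+ 2 - x ^+ 2 by nra.
pose y := Num.sqrt (l3 ^+ 2 - x ^+ 2).
have yE : y ^+ 2 = l3 ^+ 2 - x ^+ 2 by rewrite sqr_sqrtr// ltW.
have y0 : 0 < y by rewrite sqrtr_gt0.
have lx : l3 + x != 0 by rewrite gt_eqF//; lra.
have lx2 : (l3 + x) ^+ 2 + y ^+ 2 != 0.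
  by rewrite gt_eqF// ltr_wpDl ?sqr_ge0// exprn_gt0.
have lxE : (l3 + x) ^+ 2 + y ^+ 2 = 2 * l3 * (l3 + x) by rewrite yE; ring.
have l30 : l3 != 0 by rewrite gt_eqF.
have cE : half_angle l3 L (y / (l3 + x)) = (L + x, y).
  have d : 1 + (y / (l3 + x)) ^+ 2 = 2 * l3 / (l3 + x).
    rewrite expr_div_n yE; field.
    exact: lx.
  rewrite /half_angle d expr_div_n yE; congr pair; field.
    by rewrite l30 lx.
  by rewrite l30 lx.
exists (y / (l3 + x)); split.
- by rewrite mulf_neq0 ?invr_neq0// gt_eqF.
- by rewrite cE.
- rewrite cE /dist /= [X in Num.sqrt X](_ : _ = l2 ^+ 2).
    by rewrite sqrtr_sqr gtr0_norm.
  rewrite sub0r sqrrN yE.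
  have -> : l2 ^+ 2 = 2 * (L - l1) * x + (L - l1) ^+ 2 + l3 ^+ 2 by rewrite xE; ring.
  ring.
Qed.

(** For fixed l1, l3, L and n, the exceptional l2 are lengths |BC| at the finitely many u of
    [fold_torsion_finite]; the union over n is countable. *)
Lemma lebesgue4_torsion : lebesgue4 torsion = 0%E.
Proof.
apply: lebesgue4_null => [|l1 l3 L].
  rewrite (_ : torsion = [set p | torsion (p.1.1.1, p.1.1.2, p.1.2, p.2)]); last first.
    by apply/seteqP; split=> -[[[? ?] ?] ?].
  apply: measurable_torsion.
  - exact: (measurableT_comp measurable_fst (measurableT_comp measurable_fst measurable_fst)).
  - exact: (measurableT_comp measurable_snd (measurableT_comp measurable_fst measurable_fst)).
  - exact: (measurableT_comp measurable_snd measurable_fst).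
  - exact: measurable_snd.
rewrite (_ : [set l2 | _] = \bigcup_n [set l2 | non_grashof (l1, l2, l3, L) /\
  (iter n.+1 (fold L) (aligned_config (l1, l2, l3, L))).2.2 =
    (aligned_config (l1, l2, l3, L)).2.2]); last first.
  apply/seteqP; split=> l2.
    by move=> [n _ /andP[G /eqP e]]; exists n.
  by move=> [n _ [G /eqP e]]; exists n => //=; apply/andP.
apply: bigcup_countable => // n _; apply: finite_set_countable.
have [[l1_gt0 l3_gt0 l1L l3L]|h] :=
  pselect [/\ 0 < l1, 0 < l3, l1 < L & l3 < L]; last first.
  rewrite (_ : [set _ | _] = set0)//; apply/seteqP; split=> // l2 [] /and5P[? ? ? ? /and4P[*]].
  by apply: h; split=> //; lra.
have /(finite_image (fun u => dist (l1, 0) (half_angle l3 L u))) :=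
  fold_torsion_finite n l1_gt0 l3_gt0 l1L l3L.
apply: sub_finite_set => l2 [G].
have [u [u0 -> l2E]] := aligned_config_half_angle G.
by move=> e; exists u.
Qed.

Lemma ae_not_torsion : {ae @lebesgue4 R, forall p, ~ torsion p}.
Proof.
exists torsion; split; [|exact: lebesgue4_torsion|by move=> p /contrapT].
rewrite (_ : torsion = [set p | torsion (p.1.1.1, p.1.1.2, p.1.2, p.2)]); last first.
  by apply/seteqP; split=> -[[[? ?] ?] ?].
apply: measurable_torsion.
- exact: (measurableT_comp measurable_fst (measurableT_comp measurable_fst measurable_fst)).
- exact: (measurableT_comp measurable_snd (measurableT_comp measurable_fst measurable_fst)).
- exact: (measurableT_comp measurable_snd measurable_fst).
- exact: measurable_snd.
Qed.

End NullSets.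

(** * Density of the multiples of an irrational number modulo 1 *)

Section Density.
Context {R : realType}.

(** Dirichlet's pigeonhole: of N + 1 fractional parts of multiples of alpha, two share one of N
    intervals of length 1 / N < e. *)
Lemma small_multiple (alpha e : R) : 0 < e ->
  exists n (m : int), (0 < n)%N /\ `|n%:R * alpha + m%:~R| < e.
Proof.
move=> e_gt0; pose fr (k : nat) := k%:R * alpha - (Num.floor (k%:R * alpha))%:~R.
have fr0 k : 0 <= fr k by rewrite subr_ge0 Num.Theory.floor_le.
have fr1 k : fr k < 1.
  by rewrite ltrBlDr; have := Num.Theory.floorD1_gt (k%:R * alpha); rewrite intrD addrC.
pose N := (Num.truncn e^-1).+1.
have N_gt0 : 0 < N%:R :> R by rewrite ltr0n.
have eN : 1 < e * N%:R.
  have : e^-1 < N%:R by apply: Num.Theory.truncnS_gt.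
  by rewrite -(ltr_pM2l e_gt0 e^-1) divff ?gt_eqF.
clearbody N.
have bin k : (Num.truncn (fr k * N%:R) < N)%N.
  rewrite Num.Theory.truncn_lt_nat ?mulr_ge0 ?(ltW N_gt0)//.
  by rewrite -[ltRHS]mul1r ltr_pM2r.
pose f (i : 'I_N.+1) : 'I_N := Ordinal (bin i).
have /injectivePn[i [j ij fij]] : ~~ injectiveb f.
  by apply/negP => /injectiveP/leq_card; rewrite !card_ord ltnn.
wlog lt_ij : i j ij fij / (i < j)%N => [hw|].
  have := ij; rewrite -val_eqE neq_ltn => /orP[|] h; first exact: (hw i j).
  by apply: (hw j i) => //; rewrite eq_sym.
exists (j - i)%N, (Num.floor (i%:R * alpha) - Num.floor (j%:R * alpha)).
split; first by rewrite subn_gt0.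
have -> : (j - i)%:R * alpha + (Num.floor (i%:R * alpha) - Num.floor (j%:R * alpha))%:~R
  = fr j - fr i by rewrite /fr natrB ?(ltnW lt_ij)// intrB mulrBl; ring.
have h k : (Num.truncn (fr k * N%:R))%:R <= fr k * N%:R < (Num.truncn (fr k * N%:R)).+1%:R.
  by apply: Num.Theory.truncn_itv; exact: mulr_ge0 (fr0 k) (ltW N_gt0).
have /(congr1 val) /= fijE := fij.
have /andP[] := h i; have /andP[] := h j; rewrite -fijE -!natr1.
set r := (Num.truncn _)%:R => j1 j2 i1 i2.
rewrite -(ltr_pM2r N_gt0) -[X in _ * X](gtr0_norm N_gt0) -normrM mulrBl.
by rewrite (lt_trans _ eN)// ltr_norml; apply/andP; split; lra.
Qed.

Lemma dense_multiples (alpha x e : R) :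
  (forall n (m : int), n.+1%:R * alpha != m%:~R) -> 0 < e ->
  exists n (m : int), `|n%:R * alpha + m%:~R - x| < e.
Proof.
move=> irr e_gt0; have [n [m [n_gt0]]] := small_multiple alpha e_gt0.
set d := _ + _ => d_lt.
have d0 : d != 0.
  apply: contra_neq (irr n.-1 (- m)) => d0; rewrite prednK// mulrNz.
  by apply/eqP; rewrite -addr_eq0 -/d d0.
(* Only n >= 0 is allowed, so x is first moved by an integer to the side to which d points; then [k]
   steps of size |d| < e stop within |d| of it. *)
have [M yM] : exists M : int, 0 <= (x + M%:~R) / d.
  have xt : `|x| < (Num.truncn `|x|).+1%:R by apply: Num.Theory.truncnS_gt.
  move: xt; rewrite ltr_norml => /andP[x1 x2].
  case: (ltgtP d 0) d0 => // d_sgn _.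
    exists (- (Num.truncn `|x|).+1%:Z); rewrite ler_ndivlMr// mul0r mulrNz.
    by move: x2; rewrite -pmulrn; lra.
  by exists (Num.truncn `|x|).+1%:Z; rewrite divr_ge0 ?ltW// -pmulrn; lra.
have /andP[k1 k2] := Num.Theory.truncn_itv yM.
set k := Num.truncn _ in k1 k2; exists (k * n)%N, (k%:Z * m - M).
rewrite (_ : _ - x = (k%:R - (x + M%:~R) / d) * d); last first.
  by rewrite mulrBl divfK// /d natrM intrB intrM -pmulrn; ring.
rewrite normrM (le_lt_trans _ d_lt)// ler_piMl// ler_norml.
by move: k2; rewrite -natr1; lra.
Qed.

End Density.

(** * Derivatives, periodic autonomous equations and Gronwall's lemma *)

Section Calculus.
Context {R : realType}.
Implicit Types (f g df : R -> R) (t a b x : R).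

Lemma is_derive_cstf (a t : R) : is_derive t 1 (fun=> a) 0.
Proof. exact: is_derive_cst. Qed.

Lemma is_derive_addf f g t a b : is_derive t 1 f a -> is_derive t 1 g b ->
  is_derive t 1 (fun x => f x + g x) (a + b).
Proof. exact: is_deriveD. Qed.

Lemma is_derive_subf f g t a b : is_derive t 1 f a -> is_derive t 1 g b ->
  is_derive t 1 (fun x => f x - g x) (a - b).
Proof. exact: is_deriveB. Qed.

Lemma is_derive_oppf f t a : is_derive t 1 f a ->
  is_derive t 1 (fun x => - f x) (- a).
Proof. exact: is_deriveN. Qed.

Lemma is_derive_mulf f g t a b : is_derive t 1 f a -> is_derive t 1 g b ->
  is_derive t 1 (fun x => f x * g x) (f t * b + g t * a).
Proof. exact: is_deriveM. Qed.

Lemma is_derive_invf f t a : f t != 0 -> is_derive t 1 f a ->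
  is_derive t 1 (fun x => (f x)^-1) (- (a / f t ^+ 2)).
Proof.
move=> f0 fa; rewrite -mulNr mulrC mulrN -mulNr; exact: is_deriveV.
Qed.

Lemma is_derive_sqrf f t a : is_derive t 1 f a ->
  is_derive t 1 (fun x => f x ^+ 2) (2 * f t * a).
Proof. by move=> fa; have := is_deriveX 2 fa; rewrite expr1. Qed.

Lemma is_derive_sqrtf f t a : 0 < f t -> is_derive t 1 f a ->
  is_derive t 1 (fun x => Num.sqrt (f x)) (a / (2 * Num.sqrt (f t))).
Proof.
move=> f0 fa.
have s0 : 0 < Num.sqrt (f t) by rewrite sqrtr_gt0.
rewrite mulrC; apply: (@is_derive1_comp _ (@Num.sqrt R)) => //.
rewrite -[X in is_derive X](sqr_sqrtr (ltW f0)).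
apply: (@is_derive_inverse _ (fun x : R => x ^+ 2)).
- near=> x; rewrite /= sqrtr_sqr gtr0_norm//; near: x; exact: lt_nbhsr.
- near=> x; exact: exprn_continuous.
- have := is_derive_sqrf (is_derive_id (Num.sqrt (f t)) 1).
  by rewrite mulr1.
- by rewrite mulf_neq0 ?gt_eqF.
Unshelve. all: by end_near. Qed.

Lemma is_derive_continuous f df : (forall x, is_derive x 1 f (df x)) -> continuous f.
Proof. by move=> fd x; apply/differentiable_continuous/derivable1_diffP. Qed.

Lemma is_derive_gt0_incr f df : (forall x, is_derive x 1 f (df x)) ->
  (forall x, 0 < df x) -> {homo f : x y / x < y}.
Proof.
move=> fd df0 x y xy; have [|c _] := MVT xy (fun c _ => fd c).
  exact/continuous_subspaceT/(is_derive_continuous fd).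
by rewrite -subr_gt0 => ->; rewrite mulr_gt0// subr_gt0.
Qed.

Lemma is_derive_ge0_ndecr f df : (forall x, is_derive x 1 f (df x)) ->
  (forall x, 0 <= df x) -> {homo f : x y / x <= y}.
Proof.
move=> fd df0 x y xy; have [|c _] := MVT_segment xy (fun c _ => fd c).
  exact/continuous_subspaceT/(is_derive_continuous fd).
by rewrite -subr_ge0 => ->; rewrite mulr_ge0// subr_ge0.
Qed.

(** F is the signed integral from 0. Near each x it differs by a constant from an integral with
    fixed left endpoint - M, to which the fundamental theorem applies. *)
Lemma antiderivative g : continuous g -> exists F, forall x, is_derive x 1 F (g x).
Proof.
move=> cg; pose mu := @lebesgue_measure R.
have ig a b : mu.-integrable `[a, b] (EFin \o g).
  apply: continuous_compact_integrable; first exact: segment_compact.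
  exact: continuous_subspaceT.
pose Phi (M x : R) := (\int[mu]_(t in [set` `[- M, x]]) g t)%R.
pose F x := if 0 <= x then (\int[mu]_(t in [set` `]0%R, x]]) g t)%R
  else - (\int[mu]_(t in [set` `]x, 0%R]]) g t)%R.
have FE M x : - M < x -> 0 < M -> F x = Phi M x - Phi M 0.
  move=> Mx M0; rewrite /F; case: leP => x0.
    by rewrite -(@Rintegral_itvB _ _ (BLeft (- M)))//= ?bnd_simp//; lra.
  by rewrite -(@Rintegral_itvB _ _ (BLeft (- M)))//= ?bnd_simp ?opprB//; lra.
exists F => x; pose M := `|x| + 1.
have Mx : - M < x by rewrite /M; have := ler_norm (- x); rewrite normrN; lra.
have M0 : 0 < M by rewrite ltr_wpDl.
apply: (@near_eq_is_derive _ _ _ (fun y => Phi M y - Phi M 0)).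
  by near=> y; rewrite (FE M)//; near: y; exact: lt_nbhsr.
rewrite -[g x]subr0; apply: is_derive_subf.
have [|d dE] := @continuous_FTC1_closed R g (- M) x (x + 1) _ (ig _ _) Mx (cg x).
  by rewrite ltrDl.
by apply: DeriveDef => //; rewrite -derive1E.
Unshelve. all: by end_near. Qed.

(** Separation of variables: the time F, with derivative 1 / G, is an increasing bijection that
    grows by a constant P over each period p, and theta is its inverse. *)
Lemma periodic_ode (G : R -> R) (p : R) : continuous G -> (forall x, 0 < G x) ->
  0 < p -> (forall x, G (x + p) = G x) ->
  exists theta P, [/\ 0 < P, forall t, is_derive t 1 theta (G (theta t)),
    forall t, theta (t + P) = theta t + p & forall y, exists t, theta t = y].
Proof.
move=> cG G0 p_gt0 Gp.
have [F Fd] : exists F, forall x, is_derive x 1 F (G x)^-1.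
  by apply: antiderivative => x; apply: cvgV; rewrite ?gt_eqF//; exact: cG.
have F_incr : {homo F : x y / x < y}.
  by apply: is_derive_gt0_incr Fd _ => x; rewrite invr_gt0.
have F_inj : injective F.
  by move=> x y Fxy; case: (ltgtP x y) => // /F_incr; rewrite Fxy ltxx.
pose P := F p - F 0.
have P_gt0 : 0 < P by rewrite subr_gt0 F_incr.
have FP x : F (x + p) = F x + P.
  have Fp (y : R) : is_derive y 1 (fun y => F (y + p) - F y) 0.
    rewrite -(subrr (G y)^-1); apply: is_derive_subf => //.
    rewrite -[X in is_derive _ _ _ X]mulr1 -(Gp y).
    apply: (@is_derive1_comp _ F (fun y => y + p)) => //.
    by rewrite -[X in is_derive _ _ _ X]addr0; apply: is_derive_addf.
  by have /= := is_derive_0_is_cst x 0 Fp; rewrite add0r /P; lra.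
clearbody P.
have FnP n x : F (x + n%:R * p) = F x + n%:R * P.
  elim: n => [|n ih]; first by rewrite !mul0r !addr0.
  by rewrite -natr1 !mulrDl !mul1r !addrA FP ih.
have F_surj y : exists x, F x = y.
  pose n := (Num.truncn (`|y - F 0| / P)).+1.
  have : `|y - F 0| / P < n%:R by apply: Num.Theory.truncnS_gt.
  rewrite ltr_pdivrMr// ltr_norml => /andP[y1 y2].
  have n1 := FnP n 0; have n2 := FnP n (0 - n%:R * p).
  rewrite add0r in n1; rewrite subrK sub0r in n2.
  have np : - (n%:R * p) <= n%:R * p.
    by rewrite ge0_cp// mulr_ge0// ltW.
  have [||x _ <-] := @IVT R F _ _ y np; last by exists x.
    exact/continuous_subspaceT/(is_derive_continuous Fd).
  apply/andP; split; first by rewrite ge_min; apply/orP; left; lra.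
  by rewrite le_max; apply/orP; right; lra.
have [theta FK] := choice F_surj.
have thetaK x : theta (F x) = x by apply: F_inj; rewrite FK.
exists theta, P; split=> // [t|t|y].
- rewrite -{1}(FK t) -[G _]invrK; apply: is_derive_inverse => //.
  + by near=> x; rewrite thetaK.
  + by near=> x; exact: (is_derive_continuous Fd).
  + by rewrite invr_eq0 gt_eqF.
- by apply: F_inj; rewrite FP !FK.
- by exists (F y).
Unshelve. all: by end_near. Qed.

(** exp (- K t) f is nonincreasing, which settles t >= 0; exp (K t) f is nondecreasing, which
    settles t < 0. *)
Lemma gronwall_eq0 (f df : R -> R) (K : R) : (forall t, is_derive t 1 f (df t)) ->
  (forall t, 0 <= f t) -> (forall t, `|df t| <= K * f t) -> f 0 = 0 ->
  forall t, f t = 0.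
Proof.
move=> fd f0 dfK f00 t.
  have ed (s k : R) : is_derive s 1 (fun s => expR (k * s) * f s)
    (expR (k * s) * (df s + k * f s)).
  have kd : is_derive s 1 (fun s => k * s) k.
    by have := is_derive_mulf (is_derive_cst k s 1) (is_derive_id s 1);
      rewrite /cst mulr1 mulr0 addr0.
  have -> : expR (k * s) * (df s + k * f s) =
      expR (k * s) * df s + f s * (expR (k * s) * k) by ring.
  apply: is_derive_mulf => //.
apply/eqP; rewrite eq_le f0 andbT.
have [t0|t0] := leP 0 t.
  have /(_ _ _ t0) : {homo (fun s => - (expR (- K * s) * f s)) : x y / x <= y}.
    apply: is_derive_ge0_ndecr (fun s => is_derive_oppf (ed s (- K))) _ => s.
    rewrite -mulrN mulr_ge0 ?expR_ge0//; have := dfK s; rewrite ler_norml; lra.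
  by rewrite f00 mulr0 oppr0 oppr_ge0 pmulr_rle0 ?expR_gt0.
have /(_ _ _ (ltW t0)) : {homo (fun s => expR (K * s) * f s) : x y / x <= y}.
  apply: is_derive_ge0_ndecr (fun s => ed s K) _ => s.
  rewrite mulr_ge0 ?expR_ge0//; have := dfK s; rewrite ler_norml; lra.
by rewrite f00 mulr0 pmulr_rle0 ?expR_gt0.
Qed.

End Calculus.

(** Run under [is_derive_eq], it builds the unknown derivative and leaves the nonvanishing of
    denominators as goals. *)
Ltac derive := repeat first [ eassumption
  | eapply is_derive_addf | eapply is_derive_oppf | eapply is_derive_invf
  | eapply is_derive_sqrf | eapply is_derive_mulf | eapply is_derive_cstf ].

(** * The Hamiltonian flow, its reversal by the pops, and uniqueness of its solutions *)

Section Flow.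
Context {R : realType} (L : R).
Implicit Types (z u v : R -> config R) (c : config R) (t : R).

(* Twice the signed areas of BCD and ABC. *)
Definition area_BCD c : R := (c.2.1 - L) * c.1.2 - c.2.2 * (c.1.1 - L).
Definition area_ABC c : R := c.1.1 * c.2.2 - c.1.2 * c.2.1.

(* Up to a constant factor, the Hamiltonian flow of |BC|^2 in the angles of AB
   and DC. *)
Definition flow z := forall t,
  [/\ is_derive t 1 (fun t => (z t).1.1) (- area_BCD (z t) * (z t).1.2),
      is_derive t 1 (fun t => (z t).1.2) (area_BCD (z t) * (z t).1.1),
      is_derive t 1 (fun t => (z t).2.1) (area_ABC (z t) * (z t).2.2) &
      is_derive t 1 (fun t => (z t).2.2) (- area_ABC (z t) * ((z t).2.1 - L))].

Lemma is_derive_reverse (f : R -> R) t a :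
  is_derive (- t) 1 f a -> is_derive t 1 (fun t => f (- t)) (- a).
Proof.
move=> fa; rewrite -[- a]mulrN1.
by apply: (@is_derive1_comp _ f -%R) => //; exact: is_deriveNid.
Qed.

Lemma is_derive_translate (f : R -> R) t a d :
  is_derive (t + d) 1 f a -> is_derive t 1 (fun t => f (t + d)) a.
Proof.
move=> fa; rewrite -[a]mulr1.
apply: (@is_derive1_comp _ f (fun t => t + d)) => //.
rewrite -[X in is_derive _ _ _ X]addr0; exact: is_derive_addf.
Qed.

Lemma flow_translate z d : flow z -> flow (fun t => z (t + d)).
Proof. by move=> fz t; have [*] := fz (t + d); split; exact: is_derive_translate. Qed.

(** Time reversal changes the sign of the field. The pop negates [area_ABC], which restores the
    equations of C; those of the new B follow by differentiation. The other pop negates [area_BCD]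
    likewise. *)
Lemma flow_pop12 z : flow z -> (forall t, groundA R <> (z t).2) ->
  flow (fun t => (reflection (groundA R) (z (- t)).2 (z (- t)).1, (z (- t)).2)).
Proof.
move=> fz z0 t; have [] := fz (- t).
move=> /is_derive_reverse d1 /is_derive_reverse d2.
move=> /is_derive_reverse d3 /is_derive_reverse d4; move: (z0 (- t)).
move: d1 d2 d3 d4; rewrite /area_ABC /area_BCD /reflection /=.
case E : (z (- t)) => [[x1 x2] [y1 y2]] /=.
move=> d1 d2 d3 d4 yA.
have n0 : y1 ^+ 2 + y2 ^+ 2 != 0.
  apply: contra_notN yA; rewrite paddr_eq0 ?sqr_ge0// !sqrf_eq0.
  by move=> /andP[/eqP -> /eqP ->].
have n0' : (y1 - 0) ^+ 2 + (y2 - 0) ^+ 2 != 0 by rewrite !subr0.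
split; (eapply is_derive_eq; [derive; rewrite /= ?E; exact: n0' | rewrite /= ?E /=; field]) => //.
Qed.

Lemma flow_pop23 z : flow z -> (forall t, (z t).1 <> groundD L) ->
  flow (fun t => ((z (- t)).1, reflection (z (- t)).1 (groundD L) (z (- t)).2)).
Proof.
move=> fz z0 t; have [] := fz (- t).
move=> /is_derive_reverse d1 /is_derive_reverse d2.
move=> /is_derive_reverse d3 /is_derive_reverse d4; move: (z0 (- t)).
move: d1 d2 d3 d4; rewrite /area_ABC /area_BCD /reflection /groundD /=.
case E : (z (- t)) => [[x1 x2] [y1 y2]] /=.
move=> d1 d2 d3 d4 xD.
have n0 : (L - x1) ^+ 2 + x2 ^+ 2 != 0.
  apply: contra_notN xD; rewrite paddr_eq0 ?sqr_ge0// !sqrf_eq0 subr_eq0.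
  by move=> /andP[/eqP -> /eqP ->].
have n0'' : (L - x1) ^+ 2 + (- x2) ^+ 2 != 0 by rewrite sqrrN.
have n0' : (L - x1) ^+ 2 + (0 - x2) ^+ 2 != 0 by rewrite sub0r.
split; (eapply is_derive_eq; [derive; rewrite /= ?E; exact: n0' | rewrite /= ?E /=; field]) => //.
Qed.

Lemma ler_norm_combination (M p1 p2 q1 q2 m1 m2 m3 m4 : R) :
  `|m1| <= M -> `|m2| <= M -> `|m3| <= M -> `|m4| <= M ->
  `|p1 * m1 + p2 * m2 + q1 * m3 + q2 * m4| <= M * (`|p1| + `|p2| + `|q1| + `|q2|).
Proof.
move=> h1 h2 h3 h4; rewrite !mulrDr.
have bound (p m : R) : `|m| <= M -> `|p * m| <= M * `|p|.
  by move=> mM; rewrite normrM mulrC ler_wpM2r.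
by do 3!(apply: (le_trans (ler_normD _ _)); apply: lerD; last exact: bound); exact: bound.
Qed.

(** The left side is the derivative of the squared distance of two solutions. As the field rotates B
    about A and C about D, it reduces to 2 (s - s') times a linear form in the differences, plus the
    same for w. Each factor is at most M S, and S^2 is at most 4 times the squared distance. *)
Lemma flow_field_lipschitz (M b1 b2 c1 c2 x1 x2 y1 y2 : R) :
  let s := (c1 - L) * b2 - c2 * (b1 - L) in
  let s' := (y1 - L) * x2 - y2 * (x1 - L) in
  let w := b1 * c2 - b2 * c1 in
  let w' := x1 * y2 - x2 * y1 in
  [/\ `|b2| <= M, `|b1 - L| <= M, `|c1| <= M & `|c2| <= M] ->
  [/\ `|x1| <= M, `|x2| <= M, `|y2| <= M & `|y1 - L| <= M] ->
  `|2 * (b1 - x1) * (- s * b2 - - s' * x2) + 2 * (b2 - x2) * (s * b1 - s' * x1)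
    + 2 * (c1 - y1) * (w * c2 - w' * y2)
    + 2 * (c2 - y2) * (- w * (c1 - L) - - w' * (y1 - L))|
  <= 16 * M ^+ 2 * ((b1 - x1) ^+ 2 + (b2 - x2) ^+ 2 + (c1 - y1) ^+ 2 + (c2 - y2) ^+ 2).
Proof.
move=> s s' w w' [hb2 hb1 hc1 hc2] [hx1 hx2 hy2 hy1].
have M0 : 0 <= M by exact: le_trans hb2.
pose p1 := b1 - x1; pose p2 := b2 - x2; pose q1 := c1 - y1; pose q2 := c2 - y2.
rewrite -/p1 -/p2 -/q1 -/q2.
set S := `|p1| + `|p2| + `|q1| + `|q2|.
have S0 : 0 <= S by rewrite !addr_ge0.
have n0 : `|0 : R| <= M by rewrite normr0.
have hsigma : `|p1 * - y2 + p2 * (y1 - L) + q1 * b2 + q2 * - (b1 - L)| <= M * S.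
  by apply: ler_norm_combination => //; rewrite normrN.
have homega : `|p1 * c2 + p2 * - c1 + q1 * - x2 + q2 * x1| <= M * S.
  by apply: ler_norm_combination => //; rewrite normrN.
have hp : `|p1 * - x2 + p2 * x1 + q1 * 0 + q2 * 0| <= M * S.
  by apply: ler_norm_combination => //; rewrite normrN.
have hq : `|p1 * 0 + p2 * 0 + q1 * y2 + q2 * - (y1 - L)| <= M * S.
  by apply: ler_norm_combination => //; rewrite normrN.
have -> : 2 * p1 * (- s * b2 - - s' * x2) + 2 * p2 * (s * b1 - s' * x1)
    + 2 * q1 * (w * c2 - w' * y2) + 2 * q2 * (- w * (c1 - L) - - w' * (y1 - L)) =
  2 * ((p1 * - y2 + p2 * (y1 - L) + q1 * b2 + q2 * - (b1 - L)) *
       (p1 * - x2 + p2 * x1 + q1 * 0 + q2 * 0)) +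
  2 * ((p1 * c2 + p2 * - c1 + q1 * - x2 + q2 * x1) *
       (p1 * 0 + p2 * 0 + q1 * y2 + q2 * - (y1 - L))).
  by rewrite /s /s' /w /w' /p1 /p2 /q1 /q2; ring.
have prod (a b : R) : `|a| <= M * S -> `|b| <= M * S -> `|2 * (a * b)| <= 2 * (M * S) ^+ 2.
  move=> ha hb; rewrite !normrM [`|2|]gtr0_norm// ler_pM2l// expr2.
  by apply: ler_pM.
apply: (le_trans (ler_normD _ _)).
apply: (le_trans (lerD (prod _ _ hsigma hp) (prod _ _ homega hq))).
rewrite -subr_ge0.
rewrite (_ : _ - _ = 4 * M ^+ 2 * (4 * (p1 ^+ 2 + p2 ^+ 2 + q1 ^+ 2 + q2 ^+ 2) - S ^+ 2));
  last by ring.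
rewrite mulr_ge0 ?mulr_ge0 ?sqr_ge0// /S.
rewrite -[p1 ^+ 2]real_normK ?num_real// -[p2 ^+ 2]real_normK ?num_real//.
rewrite -[q1 ^+ 2]real_normK ?num_real// -[q2 ^+ 2]real_normK ?num_real//.
move: `|p1| `|p2| `|q1| `|q2| => a b c d.
rewrite (_ : _ - _ = (a - b) ^+ 2 + (a - c) ^+ 2 + (a - d) ^+ 2 +
  (b - c) ^+ 2 + (b - d) ^+ 2 + (c - d) ^+ 2); last by ring.
by rewrite !addr_ge0 ?sqr_ge0.
Qed.

(** Gronwall's lemma for the squared distance. The bounds on u and v differ because expanding s - s'
    and w - w' mixes their coordinates. *)
Lemma flow_unique M u v : flow u -> flow v ->
  (forall t, [/\ `|(u t).1.2| <= M, `|(u t).1.1 - L| <= M, `|(u t).2.1| <= M &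
    `|(u t).2.2| <= M]) ->
  (forall t, [/\ `|(v t).1.1| <= M, `|(v t).1.2| <= M, `|(v t).2.2| <= M &
    `|(v t).2.1 - L| <= M]) ->
  u 0 = v 0 -> u =1 v.
Proof.
move=> fu fv Mu Mv uv0.
pose f t := ((u t).1.1 - (v t).1.1) ^+ 2 + ((u t).1.2 - (v t).1.2) ^+ 2 +
  ((u t).2.1 - (v t).2.1) ^+ 2 + ((u t).2.2 - (v t).2.2) ^+ 2.
have f0 : forall t, f t = 0.
  apply: (gronwall_eq0 (K := 16 * M ^+ 2) _ _
    (fun t => flow_field_lipschitz (Mu t) (Mv t))).
  - move=> t; have [? ? ? ?] := fu t; have [? ? ? ?] := fv t.
    by eapply is_derive_eq; [derive|].
  - by move=> t; rewrite !addr_ge0 ?sqr_ge0.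
  - by rewrite /f uv0; ring.
move=> t; move: (f0 t); rewrite /f.
case: (u t) (v t) => [[b1 b2] [c1 c2]] [[x1 x2] [y1 y2]] /= /eqP.
rewrite paddr_eq0 ?addr_ge0 ?sqr_ge0// paddr_eq0 ?addr_ge0 ?sqr_ge0//.
rewrite paddr_eq0 ?sqr_ge0// !sqrf_eq0 !subr_eq0.
by move=> /andP[/andP[/andP[/eqP -> /eqP ->] /eqP ->] /eqP ->].
Qed.

End Flow.

(** * Explicit parametrization of the configurations by an angle theta *)

Section Parametrization.
Context {R : realType}.

Definition on_linkage (l1 l2 l3 L : R) (c : config R) :=
  [/\ c.1.1 ^+ 2 + c.1.2 ^+ 2 = l1 ^+ 2,
      (c.1.1 - c.2.1) ^+ 2 + (c.1.2 - c.2.2) ^+ 2 = l2 ^+ 2 &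
      (c.2.1 - L) ^+ 2 + c.2.2 ^+ 2 = l3 ^+ 2].

(* B = (b1, b2), p is the coordinate of DC along DB, in units of DB, and s is
   twice the signed area of BCD. *)
Definition erect (L : R) (b1 b2 s p : R) : config R :=
  let n := (b1 - L) ^+ 2 + b2 ^+ 2 in
  ((b1, b2), (L + p * (b1 - L) + s / n * b2, p * b2 - s / n * (b1 - L))).

Lemma flow_erect (L : R) (b1 b2 s p : R -> R) :
  let n t := (b1 t - L) ^+ 2 + b2 t ^+ 2 in
  (forall t, n t != 0) ->
  (forall t : R, [/\ is_derive t 1 b1 (- s t * b2 t), is_derive t 1 b2 (s t * b1 t),
    is_derive t 1 s (L * b2 t * (s t ^+ 2 / n t + p t ^+ 2 * n t - n t * p t)) &
    is_derive t 1 p (L * s t * b2 t * (1 - 2 * p t) / n t)]) ->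
  flow L (fun t => erect L (b1 t) (b2 t) (s t) (p t)).
Proof.
move=> n n0 d t; move: (d t) (n0 t); rewrite /n => -[d1 d2 d3 d4] nt0.
rewrite /erect; split; (eapply is_derive_eq; [derive; exact: nt0|];
  rewrite /area_BCD /area_ABC /=; field; exact: nt0).
Qed.

(** The condition on s is Heron's formula for BCD, and the value of p is the law of cosines. *)
Lemma erect_on_linkage (l1 l2 l3 L b1 b2 s : R) :
  let n := (b1 - L) ^+ 2 + b2 ^+ 2 in n != 0 ->
  b1 ^+ 2 + b2 ^+ 2 = l1 ^+ 2 ->
  4 * s ^+ 2 = ((l2 + l3) ^+ 2 - n) * (n - (l2 - l3) ^+ 2) ->
  on_linkage l1 l2 l3 L (erect L b1 b2 s ((n + l3 ^+ 2 - l2 ^+ 2) / (2 * n))).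
Proof.
move=> n n0 bE sE; rewrite /erect -/n.
set p := (_ / (2 * n)).
have sn : s ^+ 2 / n + p ^+ 2 * n = l3 ^+ 2.
  have -> : s ^+ 2 = ((l2 + l3) ^+ 2 - n) * (n - (l2 - l3) ^+ 2) / 4.
    by rewrite -sE; field.
  by rewrite /p; field.
have pn : n - 2 * p * n + l3 ^+ 2 = l2 ^+ 2 by rewrite /p; field.
split=> //=.
  rewrite -pn -sn {2 4}/n; clearbody p; rewrite /n in n0 *; field; exact: n0.
by rewrite -sn; clearbody p; rewrite /n in n0 *; field; exact: n0.
Qed.

Lemma on_linkage_erect (l1 l2 l3 L : R) (c : config R) :
  let n := (c.1.1 - L) ^+ 2 + c.1.2 ^+ 2 in n != 0 ->
  on_linkage l1 l2 l3 L c ->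
  c = erect L c.1.1 c.1.2 (area_BCD L c) ((n + l3 ^+ 2 - l2 ^+ 2) / (2 * n)) /\
  4 * area_BCD L c ^+ 2 = ((l2 + l3) ^+ 2 - n) * (n - (l2 - l3) ^+ 2).
Proof.
case: c => [[b1 b2] [c1 c2]] n n0 [/= bE bcE cE]; rewrite /area_BCD /= /n /=.
have -> : ((l2 + l3) ^+ 2 - ((b1 - L) ^+ 2 + b2 ^+ 2)) *
    ((b1 - L) ^+ 2 + b2 ^+ 2 - (l2 - l3) ^+ 2) =
    4 * (l3 ^+ 2 * ((b1 - L) ^+ 2 + b2 ^+ 2)) -
    ((b1 - L) ^+ 2 + b2 ^+ 2 + l3 ^+ 2 - l2 ^+ 2) ^+ 2 by ring.
rewrite -bcE -cE; split; last by ring.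
rewrite /n /= in n0; rewrite /erect; congr (_, (_, _)); field; exact: n0.
Qed.

Context (l1 l2 l3 L : R) (G : non_grashof (l1, l2, l3, L)).

(* sin of half the largest angle between AB and AD *)
Definition kmax : R := Num.sqrt (((l2 + l3) ^+ 2 - (L - l1) ^+ 2) / (4 * (L * l1))).

(* With alpha the angle between AD and AB, the linkage is parametrized by theta
   through sin (alpha / 2) = kmax sin theta, the sign of cos theta being the
   orientation of BCD. In the next definitions x stands for sin theta and y for
   cos theta. *)
Definition cos_half (x : R) : R := Num.sqrt (1 - (kmax * x) ^+ 2).
Definition root_factor (x : R) : R :=
  Num.sqrt ((L - l1) ^+ 2 - (l2 - l3) ^+ 2 + 4 * (L * l1) * (kmax * x) ^+ 2).
Definition coordB1 (x : R) : R := l1 * (1 - 2 * (kmax * x) ^+ 2).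
Definition coordB2 (x : R) : R := 2 * l1 * (kmax * x * cos_half x).
Definition sqr_BD (x : R) : R := (L - l1) ^+ 2 + 4 * (L * l1) * (kmax * x) ^+ 2.
Definition area (x y : R) : R := Num.sqrt (L * l1) * kmax * y * root_factor x.
Definition along (x : R) : R := (sqr_BD x + l3 ^+ 2 - l2 ^+ 2) / (2 * sqr_BD x).
Definition linkage_param (x y : R) : config R :=
  erect L (coordB1 x) (coordB2 x) (area x y) (along x).
(** The rate of theta along the flow: alpha turns at rate [area], and differentiating sin (alpha /
    2) = kmax sin theta cancels kmax cos theta. *)
Definition speed (x : R) : R := Num.sqrt (L * l1) / 2 * cos_half x * root_factor x.

Lemma Ll1_gt0 : 0 < L * l1.
Proof. by case/and5P: G => l1_gt0 _ _ L_gt0 _; rewrite mulr_gt0. Qed.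

Lemma sqr_sqrt_Ll1 : Num.sqrt (L * l1) ^+ 2 = L * l1.
Proof. by rewrite sqr_sqrtr// ltW// Ll1_gt0. Qed.

Lemma kmax_arg_gt0 : 0 < ((l2 + l3) ^+ 2 - (L - l1) ^+ 2) / (4 * (L * l1)).
Proof.
case/and5P: G => l1_gt0 l2_gt0 l3_gt0 L_gt0 /and4P[? ? ? ?].
by rewrite divr_gt0 ?mulr_gt0 ?Ll1_gt0//; nra.
Qed.

Lemma kmax_gt0 : 0 < kmax. Proof. by rewrite sqrtr_gt0 kmax_arg_gt0. Qed.

Lemma sqr_kmax : 4 * (L * l1) * kmax ^+ 2 = (l2 + l3) ^+ 2 - (L - l1) ^+ 2.
Proof.
rewrite /kmax sqr_sqrtr ?(ltW kmax_arg_gt0)// mulrC divfK//.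
by rewrite gt_eqF// mulr_gt0 ?Ll1_gt0.
Qed.

(** This is l2 + l3 < l1 + L: bars 2 and 3 cannot reach B = (- l1, 0), so alpha stays away from
    pi. *)
Lemma sqr_kmax_lt1 : kmax ^+ 2 < 1.
Proof.
have P := Ll1_gt0; rewrite -(ltr_pM2l (_ : 0 < 4 * (L * l1))) ?sqr_kmax; last by lra.
by case/and5P: G => l1_gt0 l2_gt0 l3_gt0 L_gt0 /and4P[? ? ? ?]; nra.
Qed.

Lemma cos_half_arg_gt0 x : x ^+ 2 <= 1 -> 0 < 1 - (kmax * x) ^+ 2.
Proof.
move=> x1; rewrite subr_gt0 exprMn (le_lt_trans _ sqr_kmax_lt1)//.
by rewrite -[leRHS]mulr1 ler_wpM2l ?sqr_ge0.
Qed.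

Lemma half_chord_ge0 x : 0 <= 4 * (L * l1) * (kmax * x) ^+ 2.
Proof.
apply: mulr_ge0; last exact: sqr_ge0.
by apply: mulr_ge0 => //; exact: ltW Ll1_gt0.
Qed.

(** Already at alpha = 0, where |BD| is least, |l2 - l3| < L - l1, so bars 2 and 3 never fold onto
    each other. *)
Lemma root_factor_arg_gt0 x :
  0 < (L - l1) ^+ 2 - (l2 - l3) ^+ 2 + 4 * (L * l1) * (kmax * x) ^+ 2.
Proof.
rewrite ltr_pwDl ?half_chord_ge0//.
by case/and5P: G => l1_gt0 l2_gt0 l3_gt0 L_gt0 /and4P[? ? ? ?]; nra.
Qed.

Lemma sqr_BD_gt0 x : 0 < sqr_BD x.
Proof.
rewrite /sqr_BD ltr_pwDl ?half_chord_ge0//.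
by case/and5P: G => l1_gt0 l2_gt0 l3_gt0 L_gt0 /and4P[? ? ? ?]; nra.
Qed.

Lemma sqr_cos_half x : x ^+ 2 <= 1 -> cos_half x ^+ 2 = 1 - (kmax * x) ^+ 2.
Proof. by move=> /cos_half_arg_gt0 /ltW; exact: sqr_sqrtr. Qed.

Lemma sqr_root_factor x : root_factor x ^+ 2 =
  (L - l1) ^+ 2 - (l2 - l3) ^+ 2 + 4 * (L * l1) * (kmax * x) ^+ 2.
Proof. exact: sqr_sqrtr (ltW (root_factor_arg_gt0 x)). Qed.

Lemma coordB_sqr x : x ^+ 2 <= 1 -> coordB1 x ^+ 2 + coordB2 x ^+ 2 = l1 ^+ 2.
Proof.
move=> /sqr_cos_half cE; rewrite /coordB1 /coordB2 !exprMn cE; ring.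
Qed.

Lemma sqr_BDE x : x ^+ 2 <= 1 -> (coordB1 x - L) ^+ 2 + coordB2 x ^+ 2 = sqr_BD x.
Proof.
move=> /coordB_sqr bE.
have -> : (coordB1 x - L) ^+ 2 + coordB2 x ^+ 2 =
  coordB1 x ^+ 2 + coordB2 x ^+ 2 - 2 * L * coordB1 x + L ^+ 2 by ring.
by rewrite bE /coordB1 /sqr_BD; ring.
Qed.

(** By the choice of [kmax], the first Heron factor is 4 L l1 kmax^2 y^2; the second is the square
    of [root_factor x]. The area thus changes sign smoothly with y. *)
Lemma sqr_area x y : x ^+ 2 + y ^+ 2 = 1 ->
  4 * area x y ^+ 2 = ((l2 + l3) ^+ 2 - sqr_BD x) * (sqr_BD x - (l2 - l3) ^+ 2).
Proof.
move=> xy; rewrite /area !exprMn sqr_sqrt_Ll1 sqr_root_factor.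
have -> : y ^+ 2 = 1 - x ^+ 2 by rewrite -xy; ring.
have -> : (l2 + l3) ^+ 2 = 4 * (L * l1) * kmax ^+ 2 + (L - l1) ^+ 2.
  by rewrite sqr_kmax; ring.
by rewrite /sqr_BD; ring.
Qed.

Lemma linkage_param_on x y : x ^+ 2 + y ^+ 2 = 1 ->
  on_linkage l1 l2 l3 L (linkage_param x y).
Proof.
move=> xy; have x1 : x ^+ 2 <= 1 by rewrite -xy lerDl sqr_ge0.
rewrite /linkage_param /along -(sqr_BDE x1); apply: erect_on_linkage.
- by rewrite sqr_BDE// gt_eqF// sqr_BD_gt0.
- exact: coordB_sqr.
- by rewrite sqr_BDE//; exact: sqr_area.
Qed.

(** [c0] and [sh] are the cosine and sine of alpha / 2; x is read off from [sh], y from the area,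
    and Heron's formula gives x^2 + y^2 = 1. *)
Lemma linkage_param_surj c : on_linkage l1 l2 l3 L c ->
  exists x y, x ^+ 2 + y ^+ 2 = 1 /\ linkage_param x y = c.
Proof.
move=> c_on; have [b_sqr _ _] := c_on.
have := @on_linkage_erect l1 l2 l3 L c; case: c c_on b_sqr => [[b1 b2] [c1 c2]] c_on.
rewrite /= => bE cE.
case/and5P: (G) => l1_gt0 l2_gt0 l3_gt0 L_gt0 /and4P[? ? ? ?].
have P := Ll1_gt0.
have nE : (b1 - L) ^+ 2 + b2 ^+ 2 = l1 ^+ 2 + L ^+ 2 - 2 * L * b1 by rewrite -bE; ring.
have b1_ub : b1 <= l1 by nra.
have n_lb : (L - l1) ^+ 2 <= (b1 - L) ^+ 2 + b2 ^+ 2 by rewrite nE; nra.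
have n_lb2 : (l2 - l3) ^+ 2 < (b1 - L) ^+ 2 + b2 ^+ 2.
  by apply: lt_le_trans n_lb; nra.
have n_neq0 : (b1 - L) ^+ 2 + b2 ^+ 2 != 0.
  by rewrite gt_eqF// (le_lt_trans _ n_lb2)// sqr_ge0.
have [cE1] := cE n_neq0 c_on; set s := area_BCD _ _ => sE.
(* Since s^2 >= 0, Heron's formula bounds |BD| by l2 + l3 < l1 + L. *)
have b1_lb : - l1 < b1.
  have : 0 <= 4 * s ^+ 2 by rewrite mulr_ge0 ?sqr_ge0.
  by rewrite sE pmulr_lge0 ?subr_gt0// subr_ge0 nE; nra.
pose c0 := Num.sqrt ((l1 + b1) / (2 * l1)).
have c0_sqr : c0 ^+ 2 = (l1 + b1) / (2 * l1).
  by rewrite sqr_sqrtr// divr_ge0//; lra.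
have c0_gt0 : 0 < c0 by rewrite sqrtr_gt0 divr_gt0//; lra.
have c0_neq0 : c0 != 0 by rewrite gt_eqF.
have l1_neq0 : l1 != 0 by rewrite gt_eqF.
have l1b1 : l1 + b1 != 0 by rewrite gt_eqF//; lra.
pose sh := b2 / (2 * l1 * c0).
have sh_sqr : sh ^+ 2 = (l1 - b1) / (2 * l1).
  rewrite /sh expr_div_n !exprMn c0_sqr.
  have -> : b2 ^+ 2 = l1 ^+ 2 - b1 ^+ 2 by rewrite -bE; ring.
  by field; rewrite l1_neq0 l1b1.
have k0 : kmax != 0 by rewrite gt_eqF// kmax_gt0.
pose x := sh / kmax; have kx : kmax * x = sh by rewrite /x mulrC divfK.
pose y := s / (Num.sqrt (L * l1) * kmax * root_factor x).
have q0 : Num.sqrt (L * l1) != 0 by rewrite gt_eqF// sqrtr_gt0.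
have w0 : root_factor x != 0 by rewrite gt_eqF// sqrtr_gt0 root_factor_arg_gt0.
have BDE : sqr_BD x = (b1 - L) ^+ 2 + b2 ^+ 2.
  by rewrite /sqr_BD kx sh_sqr nE; field.
have w_sqr : root_factor x ^+ 2 = (b1 - L) ^+ 2 + b2 ^+ 2 - (l2 - l3) ^+ 2.
  by rewrite sqr_root_factor -BDE /sqr_BD; ring.
have area_xy : area x y = s by rewrite /area /y; field; rewrite q0 k0 w0.
exists x, y; split.
  have K0 : 4 * (L * l1) * kmax ^+ 2 != 0 by rewrite !mulf_neq0 ?expf_neq0// gt_eqF.
  have s_sqr : s ^+ 2 = ((l2 + l3) ^+ 2 - ((b1 - L) ^+ 2 + b2 ^+ 2)) * root_factor x ^+ 2 / 4.
    by rewrite w_sqr -sE; field.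
  apply: (mulfI K0); rewrite mulr1 [in RHS]sqr_kmax mulrDr.
  have -> : 4 * (L * l1) * kmax ^+ 2 * x ^+ 2 = sqr_BD x - (L - l1) ^+ 2.
    by rewrite /sqr_BD; ring.
  have -> : 4 * (L * l1) * kmax ^+ 2 * y ^+ 2 = (l2 + l3) ^+ 2 - sqr_BD x.
    rewrite /y expr_div_n s_sqr !exprMn sqr_sqrt_Ll1 BDE; field.
    by rewrite w0 k0 /=; rewrite gt_eqF// gt_eqF.
  by ring.
have B1 : coordB1 x = b1 by rewrite /coordB1 kx sh_sqr; field.
have B2 : coordB2 x = b2.
  rewrite /coordB2 /cos_half kx sh_sqr.
  have -> : 1 - (l1 - b1) / (2 * l1) = (l1 + b1) / (2 * l1) by field.
  by rewrite -/c0 /sh; field; rewrite c0_neq0 l1_neq0.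
by rewrite /linkage_param B1 B2 area_xy /along BDE -cE1.
Qed.

Lemma sqr_sin_le1 (t : R) : sin t ^+ 2 <= 1.
Proof. by rewrite -(cos2Dsin2 t) lerDr sqr_ge0. Qed.

Lemma is_derive_cos_half (x : R -> R) (t a : R) : x t ^+ 2 <= 1 ->
  is_derive t 1 x a ->
  is_derive t 1 (fun t => cos_half (x t)) (- (kmax ^+ 2 * x t * a / cos_half (x t))).
Proof.
move=> x1 dx; have c0 := cos_half_arg_gt0 x1.
have cc0 : cos_half (x t) != 0 by rewrite gt_eqF// sqrtr_gt0.
eapply is_derive_eq; first by eapply is_derive_sqrtf; [exact: c0|derive].
by rewrite /= -/(cos_half (x t)); field.
Qed.

Lemma is_derive_root_factor (x : R -> R) (t a : R) : is_derive t 1 x a ->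
  is_derive t 1 (fun t => root_factor (x t))
    (4 * (L * l1) * kmax ^+ 2 * x t * a / root_factor (x t)).
Proof.
move=> dx; have c0 := root_factor_arg_gt0 (x t).
have cc0 : root_factor (x t) != 0 by rewrite gt_eqF// sqrtr_gt0.
eapply is_derive_eq; first by eapply is_derive_sqrtf; [exact: c0|derive].
by rewrite /= -/(root_factor (x t)); field.
Qed.

(** Keeping x and y abstract in place of sin theta and cos theta makes the verification purely
    algebraic. *)
Lemma flow_linkage_param (x y : R -> R) : (forall t, x t ^+ 2 + y t ^+ 2 = 1) ->
  (forall t : R, is_derive t 1 x (y t * speed (x t)) /\
             is_derive t 1 y (- x t * speed (x t))) ->
  flow L (fun t => linkage_param (x t) (y t)).
Proof.
move=> xy d; have x1 t : x t ^+ 2 <= 1 by rewrite -(xy t) lerDl sqr_ge0.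
have nE t : (coordB1 (x t) - L) ^+ 2 + coordB2 (x t) ^+ 2 = sqr_BD (x t).
  exact: sqr_BDE.
apply: (@flow_erect L (fun t => coordB1 (x t)) (fun t => coordB2 (x t))
    (fun t => area (x t) (y t)) (fun t => along (x t))) => t; rewrite nE.
  by rewrite gt_eqF// sqr_BD_gt0.
have [dx dy] := d t.
have dc := is_derive_cos_half (x1 t) dx.
have dw := is_derive_root_factor dx.
have n0 : sqr_BD (x t) != 0 by rewrite gt_eqF// sqr_BD_gt0.
have c0 : cos_half (x t) != 0 by rewrite gt_eqF// sqrtr_gt0 cos_half_arg_gt0.
have w0 : root_factor (x t) != 0 by rewrite gt_eqF// sqrtr_gt0 root_factor_arg_gt0.
have cE := sqr_cos_half (x1 t).
have wE := sqr_root_factor (x t).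
have qE := sqr_sqrt_Ll1.
have yE : y t ^+ 2 = 1 - x t ^+ 2 by rewrite -(xy t); ring.
split.
- eapply is_derive_eq; first by rewrite /coordB1; derive.
  by rewrite /area /coordB2 /speed; field.
- eapply is_derive_eq; first by rewrite /coordB2; derive.
  rewrite /area /coordB1 /speed.
  transitivity (Num.sqrt (L * l1) * l1 * kmax * y t * root_factor (x t) *
    (cos_half (x t) ^+ 2 - (kmax * x t) ^+ 2)); first by field.
  by rewrite cE; ring.
- eapply is_derive_eq; first by rewrite /area; derive.
  have sE : area (x t) (y t) ^+ 2 = ((l2 + l3) ^+ 2 - sqr_BD (x t)) *
      (sqr_BD (x t) - (l2 - l3) ^+ 2) / 4 by rewrite -(sqr_area (xy t)); field.
  transitivity (Num.sqrt (L * l1) ^+ 2 * kmax * x t * cos_half (x t) / 2 *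
    (4 * (L * l1) * kmax ^+ 2 * y t ^+ 2 - root_factor (x t) ^+ 2)).
    by rewrite /speed; field.
  have kyE : 4 * (L * l1) * kmax ^+ 2 * y t ^+ 2 = (l2 + l3) ^+ 2 - sqr_BD (x t).
    by rewrite yE /sqr_BD exprMn [_ * (kmax ^+ 2 * _)]mulrA sqr_kmax; ring.
  have wnE : root_factor (x t) ^+ 2 = sqr_BD (x t) - (l2 - l3) ^+ 2.
    by rewrite wE /sqr_BD; ring.
  rewrite kyE wnE qE sE /along /coordB2; field; exact: n0.
- move: n0; rewrite /along /sqr_BD => n0.
  eapply is_derive_eq; first by derive; rewrite mulf_neq0.
  by rewrite /area /coordB2 /speed; field.
Qed.

Lemma linkage_flow : exists z P, [/\ flow L z, 0 < P, forall t, z (t + P) = z t,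
  forall t, on_linkage l1 l2 l3 L (z t) &
  forall c, on_linkage l1 l2 l3 L c -> exists t, z t = c].
Proof.
have speed_gt0 t : 0 < speed (sin t).
  rewrite /speed !mulr_gt0 ?sqrtr_gt0 ?Ll1_gt0 ?root_factor_arg_gt0//.
  exact/cos_half_arg_gt0/sqr_sin_le1.
have speed_cont : continuous (fun t : R => speed (sin t)).
  move=> t; apply/differentiable_continuous/derivable1_diffP.
  have dsin := is_derive_sin t.
  have dc := is_derive_cos_half (sqr_sin_le1 t) dsin.
  have dw := is_derive_root_factor dsin.
  have [d dE] : exists d, is_derive t 1 (fun t : R => speed (sin t)) d.
    by eexists; rewrite /speed; derive.
  exact: ex_derive.
have pi2_gt0 : 0 < pi *+ 2 :> R by rewrite pmulrn_lgt0// pi_gt0.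
have [|theta [P [P_gt0 dtheta thetaP theta_surj]]] :=
  periodic_ode speed_cont speed_gt0 pi2_gt0.
  by move=> t; rewrite sinD2pi.
exists (fun t => linkage_param (sin (theta t)) (cos (theta t))), P.
have sc t : sin (theta t) ^+ 2 + cos (theta t) ^+ 2 = 1 by rewrite addrC cos2Dsin2.
split; [|exact: P_gt0| | |].
- apply: flow_linkage_param => [|t]; [exact: sc|split].
    exact: (@is_derive1_comp _ sin theta).
  exact: (@is_derive1_comp _ cos theta).
- by move=> t; rewrite thetaP sinD2pi cosD2pi.
- by move=> t; exact: linkage_param_on.
- move=> c /linkage_param_surj[x [y [xy <-]]].
  have y1 : -1 <= y <= 1 by apply/andP; split; nra.
  have [a [<- <-]] : exists a, sin a = x /\ cos a = y.
    have sE : Num.sqrt (1 - y ^+ 2) = `|x| by rewrite -sqrtr_sqr -xy addrK.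
    have [x0|x0] := leP 0 x.
      by exists (acos y); rewrite sin_acos// acosK// sE ger0_norm.
    exists (- acos y); rewrite sinN cosN sin_acos// acosK// sE ltr0_norm//.
    by rewrite opprK.
  by have [t <-] := theta_surj a; exists t.
Qed.

End Parametrization.

(** * Pops as reflections of the time circle, and density of their orbits *)

Section Orbits.
Context {R : realType}.

Lemma dist_eq_sqr (P Q : R * R) (l : R) : 0 < l ->
  dist P Q = l <-> (P.1 - Q.1) ^+ 2 + (P.2 - Q.2) ^+ 2 = l ^+ 2.
Proof.
move=> l_gt0; rewrite /dist; split=> [<-|->]; last by rewrite sqrtr_sqr gtr0_norm.
by rewrite sqr_sqrtr// addr_ge0 ?sqr_ge0.
Qed.

Lemma dist_le (P Q : R * R) : dist P Q <= `|P.1 - Q.1| + `|P.2 - Q.2|.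
Proof.
have h : 0 <= `|P.1 - Q.1| + `|P.2 - Q.2| by rewrite addr_ge0.
rewrite /dist -(ger0_norm h) -sqrtr_sqr ler_sqrt ?sqr_ge0//.
rewrite -[leLHS](_ : `|P.1 - Q.1| ^+ 2 + `|P.2 - Q.2| ^+ 2 = _); last first.
  by rewrite !real_normK ?num_real.
by rewrite sqrrD addrAC lerDl mulrn_wge0// mulr_ge0.
Qed.

Context (l1 l2 l3 L : R) (G : non_grashof (l1, l2, l3, L)).
Notation linkage := (on_linkage l1 l2 l3 L).

Lemma configurations_on_linkage c : configurations l1 l2 l3 L c <-> linkage c.
Proof.
case/and5P: G => l1_gt0 l2_gt0 l3_gt0 _ _; rewrite /configurations /= !dist_eq_sqr//=.
rewrite /on_linkage !sub0r !sqrrN subr0.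
by split=> [[? [? ?]]|[? ? ?]].
Qed.

Definition pop12_config (c : config R) : config R := (reflection (groundA R) c.2 c.1, c.2).
Definition pop23_config (c : config R) : config R := (c.1, reflection c.1 (groundD L) c.2).

(** C lies at distance l3 < L from D. *)
Lemma on_linkage_A_neq_C c : linkage c -> groundA R <> c.2.
Proof.
case/and5P: G => l1_gt0 l2_gt0 l3_gt0 _ /and4P[? ? ? ?].
by case: c => [[b1 b2] c2] [_ _ /= + A_C]; rewrite -A_C /=; nra.
Qed.

Lemma on_linkage_B_neq_D c : linkage c -> c.1 <> groundD L.
Proof.
case/and5P: G => l1_gt0 l2_gt0 l3_gt0 _ /and4P[? ? ? ?].
by case: c => [b c2] [/= + _ _ B_D]; rewrite B_D /=; nra.
Qed.

Lemma on_linkage_pop12 c : linkage c -> linkage (pop12_config c).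
Proof.
move=> c_on; have A_C := on_linkage_A_neq_C c_on; case: c_on => h1 h2 h3.
case: c A_C h1 h2 h3 => [[b1 b2] [c1 c2]] /= A_C h1 h2 h3.
have n0 : c1 ^+ 2 + c2 ^+ 2 != 0.
  apply: contra_notN A_C; rewrite paddr_eq0 ?sqr_ge0// !sqrf_eq0.
  by move=> /andP[/eqP -> /eqP ->].
split=> //=; rewrite /reflection /= !subr0 !add0r; [rewrite -h1|rewrite -h2];
  by field.
Qed.

Lemma on_linkage_pop23 c : linkage c -> linkage (pop23_config c).
Proof.
move=> c_on; have B_D := on_linkage_B_neq_D c_on; case: c_on => h1 h2 h3.
case: c B_D h1 h2 h3 => [[b1 b2] [c1 c2]] /= B_D h1 h2 h3.
have n0 : (L - b1) ^+ 2 + (- b2) ^+ 2 != 0.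
  apply: contra_notN B_D; rewrite paddr_eq0 ?sqr_ge0// !sqrf_eq0 subr_eq0 oppr_eq0.
  by move=> /andP[/eqP <- /eqP ->].
split=> //=; rewrite /reflection /= !sub0r; [rewrite -h2|rewrite -h3];
  by field.
Qed.

Lemma on_linkage_fold c : linkage c -> linkage (fold L c).
Proof. by move=> /on_linkage_pop12 /on_linkage_pop23. Qed.

Lemma alternating_pops_fold n c : linkage c ->
  alternating_pops L Pop12 n.*2 c (iter n (fold L) c).
Proof.
elim: n c => [//|n ih] c c_on; rewrite doubleS iterSr /=.
exists (pop12_config c); first by split=> //; exact: on_linkage_A_neq_C.
exists (fold L c); last exact/ih/on_linkage_fold.
by split=> //; exact/(on_linkage_B_neq_D (c := pop12_config c))/on_linkage_pop12.
Qed.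

Lemma on_linkage_bound c : linkage c ->
  let M := l1 + l3 + L in
  [/\ `|c.1.2| <= M, `|c.1.1 - L| <= M, `|c.2.1| <= M & `|c.2.2| <= M] /\
  [/\ `|c.1.1| <= M, `|c.1.2| <= M, `|c.2.2| <= M & `|c.2.1 - L| <= M].
Proof.
case: c => [[b1 b2] [c1 c2]] [/= h1 _ h3].
case/and5P: G => l1_gt0 l2_gt0 l3_gt0 L_gt0 _.
have sq (x y r : R) : 0 < r -> x ^+ 2 + y ^+ 2 = r ^+ 2 -> - r <= x <= r.
  by move=> r0 xy; apply/andP; split; nra.
have /andP[? ?] := sq _ _ _ l1_gt0 h1; have /andP[? ?] := sq _ _ _ l3_gt0 h3.
rewrite addrC in h1; rewrite addrC in h3.
have /andP[? ?] := sq _ _ _ l1_gt0 h1; have /andP[? ?] := sq _ _ _ l3_gt0 h3.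
by split; split; rewrite ler_norml; apply/andP; split; lra.
Qed.

(** Both f (z (- t)) and z (t + a) solve the flow, and a is chosen so that they agree at t = 0. *)
Lemma reversing_pop z (f : config R -> config R) : flow L z ->
  (forall t, linkage (z t)) -> (forall c, linkage c -> exists t, z t = c) ->
  (forall c, linkage c -> linkage (f c)) -> flow L (fun t => f (z (- t))) ->
  exists a, forall t, f (z t) = z (a - t).
Proof.
move=> fz z_on z_surj f_on ff; have [a za] := z_surj _ (f_on _ (z_on 0)).
exists a => t; rewrite -{1}[t]opprK addrC.
apply: (flow_unique (M := l1 + l3 + L) ff (flow_translate a fz)).
- by move=> s; have [h _] := on_linkage_bound (f_on _ (z_on (- s))).
- by move=> s; have [_ h] := on_linkage_bound (z_on (s + a)).
- by rewrite oppr0 add0r za.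
Qed.

Lemma aligned_config_on : linkage (aligned_config (l1, l2, l3, L)).
Proof.
have [u [u0 -> l2E]] := aligned_config_half_angle G.
case/and5P: G => l1_gt0 l2_gt0 l3_gt0 L_gt0 _.
split=> /=; first by rewrite expr0n addr0.
  by have /esym := l2E; rewrite dist_eq_sqr.
have n0 : 1 + u ^+ 2 != 0 by rewrite gt_eqF// ltr_pwDl// sqr_ge0.
by field.
Qed.

Lemma pops_dense c c' (eps : R) : ~ torsion (l1, l2, l3, L) ->
  linkage c -> linkage c' -> 0 < eps ->
  exists n c1, alternating_pops L Pop12 n c c1 /\
    all2 (fun P Q => dist P Q <= eps) (vertices L c1) (vertices L c').
Proof.
move=> ntors c_on c'_on eps_gt0.
have [z [P [fz P_gt0 zP z_on z_surj]]] := linkage_flow G.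
have [a za] : exists a, forall t, pop12_config (z t) = z (a - t).
  apply: reversing_pop => //; first exact: on_linkage_pop12.
  by apply: flow_pop12 => // t; exact: on_linkage_A_neq_C.
have [b zb] : exists b, forall t, pop23_config (z t) = z (b - t).
  apply: reversing_pop => //; first exact: on_linkage_pop23.
  by apply: flow_pop23 => // t; exact: on_linkage_B_neq_D.
(* The two pops send t to a - t and then to b - (a - t) = t + tau. *)
pose tau := b - a.
have zfold n t : iter n (fold L) (z t) = z (t + n%:R * tau).
  elim: n => [|n ih]; first by rewrite mul0r addr0.
  rewrite iterS ih -[fold L _]/(pop23_config (pop12_config _)) za zb; congr z.
  by rewrite /tau -natr1; ring.
have znP n t : z (t + n%:R * P) = z t.
  elim: n => [|n ih]; first by rewrite mul0r addr0.
  by rewrite -natr1 mulrDl mul1r addrA zP.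
have zmP (m : int) t : z (t + m%:~R * P) = z t.
  case: (intP m) => [|n|n]; first by rewrite mul0r addr0.
    exact: znP.
  by rewrite -[in RHS](subrK (n.+1%:R * P) t) znP mulrNz mulNr.
(* Otherwise an iterate of F would be the identity on the orbit and fix the aligned configuration,
   contrary to [ntors]. *)
have irr n (m : int) : n.+1%:R * (tau / P) != m%:~R.
  apply/eqP => nm; apply: ntors; exists n => //; apply/andP; split; first exact: G.
  have [t <-] := z_surj _ aligned_config_on.
  have nmP : n.+1%:R * tau = m%:~R * P by rewrite -nm -mulrA divfK// gt_eqF.
  by rewrite zfold nmP zmP.
have [t tc] := z_surj _ c_on; have [t' tc'] := z_surj _ c'_on.
(* Half of eps per coordinate, because [dist_le] adds two coordinates. *)
have close (f : config R -> R) df : is_derive t' 1 (f \o z) df ->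
    \forall s \near t', `|f (z s) - f (z t')| < eps / 2.
  move=> fzd; have /differentiable_continuous : differentiable (f \o z) t'.
    by apply/derivable1_diffP.
  move=> /cvgrPdist_lt/(_ (eps / 2)); rewrite divr_gt0// => /(_ isT).
  by apply: filterS => s; rewrite distrC.
have [d1 d2 d3 d4] := fz t'.
have /nbhs_ballP[delta /= delta_gt0 ball_close] : \forall s \near t',
    all2 (fun P Q => dist P Q <= eps) (vertices L (z s)) (vertices L c').
  have h1 := close (fun c => c.1.1) _ d1; have h2 := close (fun c => c.1.2) _ d2.
  have h3 := close (fun c => c.2.1) _ d3; have h4 := close (fun c => c.2.2) _ d4.
  near=> s; rewrite -tc' /= !andbT.
  have dist0 (Q : R * R) : dist Q Q <= eps.
    by rewrite /dist !subrr expr0n addr0 sqrtr0 ltW.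
  rewrite !dist0 andbT /=.
  have e1 : `|(z s).1.1 - (z t').1.1| < eps / 2 by near: s.
  have e2 : `|(z s).1.2 - (z t').1.2| < eps / 2 by near: s.
  have e3 : `|(z s).2.1 - (z t').2.1| < eps / 2 by near: s.
  have e4 : `|(z s).2.2 - (z t').2.2| < eps / 2 by near: s.
  by apply/andP; split; apply: (le_trans (dist_le _ _)); lra.
(* Time is measured in units of P; the m whole periods do not change the configuration. *)
have [n [m nm]] := dense_multiples ((t' - t) / P) irr (divr_gt0 delta_gt0 P_gt0).
exists n.*2, (iter n (fold L) c); split; first exact: alternating_pops_fold.
rewrite -tc zfold -(zmP m); apply: ball_close.
rewrite /ball /= -(ltr_pM2r (_ : 0 < P^-1)) ?invr_gt0// distrC.
rewrite -[X in _ * X]gtr0_norm ?invr_gt0// -normrM.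
rewrite [X in `|X|](_ : _ = n%:R * (tau / P) + m%:~R - (t' - t) / P)//.
by field; rewrite gt_eqF.
Unshelve. all: by end_near. Qed.

End Orbits.

Theorem theorem1 (R : realType) :
  {ae @lebesgue4 R, forall p : R * R * R * R,
    let: (l1, l2, l3, L) := p in
    0 < l1 -> 0 < l2 -> 0 < l3 -> 0 < L ->
    Num.max 0 (Num.max (l1 - l2 - l3)
      (Num.max (- l1 + l2 - l3) (- l1 - l2 + l3))) < L ->
    L < l1 + l2 + l3 ->
    0 < - l1 + l2 - l3 + L ->
    0 < - l1 - l2 + l3 + L ->
    - l1 + l2 + l3 - L < 0 ->
    l2 <= Num.min l1 l3 \/ Num.max l1 l3 <= l2 ->
    forall c c' : config R,
      configurations l1 l2 l3 L c ->
      reachable l1 l2 l3 L c c' ->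
      forall eps : R, 0 < eps ->
      exists (k : pop_kind) (n : nat) (c1 : config R),
        alternating_pops L k n c c1 /\
        all2 (fun P Q => dist P Q <= eps) (vertices L c1) (vertices L c')}.
Proof.
have [A [mA A0 notA]] := @ae_not_torsion R.
exists A; split=> // p np; apply: notA => ntors; apply: np.
case: p ntors => [[[l1 l2] l3] L] ntors.
move=> l1_gt0 l2_gt0 l3_gt0 L_gt0 _ L_lt T1 T2 T3 _ c c' c_conf.
move=> [gamma [_ _ gamma1 gamma_conf]] eps eps_gt0.
(* [T1], [T2] and [T3] rearrange to the last three inequalities of [non_grashof]. *)
have G : non_grashof (l1, l2, l3, L).
  by apply/and5P; split=> //; apply/and4P; split; lra.
have c'_conf : configurations l1 l2 l3 L c'.
  by rewrite -gamma1; apply: gamma_conf; rewrite in_itv /= ler01 lexx.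
have [n [c1 nc1]] := pops_dense G ntors (iffLR (configurations_on_linkage G c) c_conf)
  (iffLR (configurations_on_linkage G c') c'_conf) eps_gt0.
by exists Pop12, n, c1.
Qed.
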